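(* Let $c(n)$, $n\ge 0$, be the Fourier coefficients of the modular invariant $j$. For all integers $n\ge 2$, $$\frac{e^{4\pi\sqrt n}}{\sqrt2\,n}\le c(n).$$
   Context: The modular invariant $j$ is defined for $\tau$ in the upper half-plane, with $q=e^{2\pi i\tau}$, by $$j(\tau)=\frac{\left(1+240\sum_{n\ge 1}\sigma_3(n)q^n\right)^3}{q\prod_{n\ge 1}(1-q^n)^{24}}=q^{-1}+\sum_{n\ge 0}c(n)q^n=q^{-1}+744+196884q+21493760q^2+\cdots,$$ where $\sigma_3(n)=\sum_{d\mid n}d^3$. This defines the integers $c(n)$, $n\ge 0$. *)

(* Defs.v *)
From Stdlib Require Import Reals ZArith List Arith.
From Coquelicot Require Import Coquelicot.
Open Scope R_scope.

(** Coquelicot has no complex exponential: exp (x + i y) = e^x (cos y + i sin y). *)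
Definition Cexp (z : C) : C :=
  (exp (Re z) * cos (Im z), exp (Re z) * sin (Im z)).

(** Limit of a complex sequence, taken componentwise as in Coquelicot's [C_lim];
    it is only meaningful for convergent sequences. *)
Definition Clim_seq (u : nat -> C) : C :=
  (real (Lim_seq (fun n => Re (u n))), real (Lim_seq (fun n => Im (u n)))).

(** Sum and product over the indices [n >= 1]. *)
Definition Csum1 (a : nat -> C) : C :=
  Clim_seq (fun N => fold_right Cplus (RtoC 0) (map a (seq 1 N))).

Definition Cprod1 (a : nat -> C) : C :=
  Clim_seq (fun N => fold_right Cmult (RtoC 1) (map a (seq 1 N))).

Definition sigma3 (n : nat) : nat :=
  list_sum (map (fun d => d ^ 3)%nat
                (filter (fun d => n mod d =? 0)%nat (seq 1 n))).

Definition nome (tau : C) : C := Cexp (RtoC (2 * PI) * Ci * tau)%C.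

Definition modular_j (tau : C) : C :=
  let q := nome tau in
  (Cpow (RtoC 1 + RtoC 240 * Csum1 (fun n => RtoC (INR (sigma3 n)) * Cpow q n)) 3
   / (q * Cprod1 (fun n => Cpow (RtoC 1 - Cpow q n) 24)))%C.

(** [c n] is the coefficient of [q ^ n] for [n >= 0]; the polar term [q ^ (-1)] of [j]
    is written separately.  Such a [c] is unique. *)
Definition is_j_coefficients (c : nat -> Z) : Prop :=
  forall tau : C, 0 < Im tau ->
    @is_series C_AbsRing C_NormedModule
      (fun n => RtoC (IZR (c n)) * Cpow (nome tau) n)%C
      (modular_j tau - / nome tau)%C.

(* Main.v *)
(* Since E_4 = 1 + 240 sum sigma_3(n) q^n dominates 1440 q^2 / (1 - q)^4 coefficientwise
   (sigma_3(n) >= n^3 >= n^3 - n), c(n) is at least 1440^3 h(n - 5), where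
   sum h(j) q^j = (1 - q)^(-12) prod (1 - q^m)^(-24).  The logarithmic derivative gives
   j h(j) = sum_(k >= 1) (12 + 24 sigma_1(k)) h(j - k), with positive weights, whose
   generating function at q = e^(-x) is 4 pi^2 / x^2 - 5 + O(x); this is elementary
   (zeta(2) and the trapezoid and midpoint rules for y / (e^y - 1)).  A lower bound
   A e^(4 pi sqrt n) / n for h(n - 5) propagates along the recurrence: with N = sqrt n,
   the ratio of the bounds at n - k and n is minorized by
   e^(-k x) (1 - a (e^(k v) + e^(-k v) - 2)), x = 2 pi / N - 1 / N^2, v = x / 4,
   a = O(1 / N), and the weighted sum of this is at least n - 5 as soon as n >= 289, because
   the exponent 1 of n in the bound exceeds the true exponent 3/4.  The remaining n >= 34 are
   checked by running the recurrence, and n <= 33 by computing c(n).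

   The passage from the analytic definition of j to coefficients compares functions
   of q in (0, 1/4] modulo q^(M+1). *)
Require Import Defs.
From Stdlib Require Import Reals ZArith List Lra Lia FunctionalExtensionality.
From Coquelicot Require Import Coquelicot.
Import ListNotations.
Open Scope R_scope.

(** * Coefficient sequences and logarithmic derivatives *)

(** The exponents fit together because $E_4^3$ and the discriminant both have weight 12. At
    $q=e^{-x}$ the factor $(1-q)^{-12}$ left from $E_4^3$ contributes $12/(e^x-1)=12/x-6+O(x)$ to
    the generating function of the weights, which cancels the term $-12/x$ of $24\sum_m
    m/(e^{mx}-1)=4\pi^2/x^2-12/x+1+\dots$. The constants add up to $1-6=-5$, which is also the shift
    in $j=n-5$, so the balance of the recurrence sits at $x=2\pi/\sqrt n$ to first order. Near the
    cusp $E_4\sim16\pi^4/x^4$, so replacing its coefficients by those of $1440q^2(1-q)^{-4}$ costs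
    asymptotically a factor $(90/\pi^4)^3\approx0.79$, while the slack in the bound grows like
    $n^{1/4}$. Since all weights are positive, a lower bound can be propagated with values of
    Lambert series at real $q$ alone: neither the modular transformation nor the circle method
    enters. Products are truncated at an index [M] beyond the coefficient in question, so the
    algebra is that of finite quotients of sequences. *)

Definition conv (a b : nat -> R) (n : nat) : R :=
  sum_f_R0 (fun k => a k * b (n - k)%nat) n.

Definition seq_add (a b : nat -> R) (n : nat) : R := a n + b n.

Definition shift1 (a : nat -> R) (n : nat) : R :=
  match n with O => 0 | S k => a k end.

Definition shift (m : nat) (a : nat -> R) : nat -> R := Nat.iter m shift1 a.

Definition unit_seq (n : nat) : R := match n with O => 1 | S _ => 0 end.

Definition multiples (m k : nat) : R := if (k mod m =? 0)%nat then 1 else 0.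

(* [a / (1 - q^m)]. *)
Definition divq (m : nat) (a : nat -> R) : nat -> R := conv (multiples m) a.

Lemma conv_addl a b c : conv (seq_add a b) c = seq_add (conv a c) (conv b c).
Proof.
  apply functional_extensionality; intros n; unfold conv, seq_add.
  rewrite <- sum_plus; apply sum_eq; intros; ring.
Qed.

Lemma conv_addr a b c : conv c (seq_add a b) = seq_add (conv c a) (conv c b).
Proof.
  apply functional_extensionality; intros n; unfold conv, seq_add.
  rewrite <- sum_plus; apply sum_eq; intros; ring.
Qed.

Lemma conv_shift1l a b : conv (shift1 a) b = shift1 (conv a b).
Proof.
  apply functional_extensionality; intros [|n]; unfold conv; simpl shift1.
  - simpl; ring.
  - rewrite decomp_sum by lia; simpl; ring_simplify; reflexivity.
Qed.

Lemma conv_shift1r a b : conv a (shift1 b) = shift1 (conv a b).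
Proof.
  apply functional_extensionality; intros [|n]; unfold conv.
  - simpl; ring.
  - rewrite tech5, Nat.sub_diag.
    rewrite (sum_eq _ (fun k => a k * b (n - k)%nat)); [simpl; ring|].
    intros i Hi; cbv beta; rewrite Nat.sub_succ_l by lia; reflexivity.
Qed.

Lemma conv_shiftl m a b : conv (shift m a) b = shift m (conv a b).
Proof.
  induction m as [|m IH]; [reflexivity|].
  change (conv (shift1 (shift m a)) b = shift1 (shift m (conv a b))).
  rewrite conv_shift1l, IH; reflexivity.
Qed.

Lemma conv_shiftr m a b : conv a (shift m b) = shift m (conv a b).
Proof.
  induction m as [|m IH]; [reflexivity|].
  change (conv a (shift1 (shift m b)) = shift1 (shift m (conv a b))).
  rewrite conv_shift1r, IH; reflexivity.
Qed.

Definition scale (r : R) (a : nat -> R) (n : nat) : R := r * a n.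

Lemma conv_scalel r a b : conv (scale r a) b = scale r (conv a b).
Proof.
  apply functional_extensionality; intros n; unfold conv, scale.
  rewrite scal_sum; apply sum_eq; intros; ring.
Qed.

Lemma conv_scaler r a b : conv a (scale r b) = scale r (conv a b).
Proof.
  apply functional_extensionality; intros n; unfold conv, scale.
  rewrite scal_sum; apply sum_eq; intros; ring.
Qed.

Lemma conv_unitl a : conv unit_seq a = a.
Proof.
  apply functional_extensionality; intros n; unfold conv.
  destruct n as [|n]; [simpl; ring|].
  rewrite decomp_sum by lia; simpl.
  rewrite (sum_eq _ (fun _ => 0)) by (intros; ring).
  rewrite sum_cte; ring.
Qed.

Lemma shift_val m a n :
  shift m a n = if (m <=? n)%nat then a (n - m)%nat else 0.
Proof.
  revert n; induction m as [|m IH]; intros n.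
  - simpl; rewrite Nat.sub_0_r; reflexivity.
  - change (shift1 (shift m a) n = if (S m <=? n)%nat then a (n - S m)%nat else 0).
    destruct n as [|n]; [reflexivity|]; simpl; apply IH.
Qed.

(** The equation $y=z+q^my$ determines coefficient $n$ from coefficient $n-m$. This stands in for
    division by $1-q^m$: identities between quotients are proved by exhibiting both sides as
    solutions. *)
Lemma shift_fix_unique m z y y' : (0 < m)%nat ->
  y = seq_add z (shift m y) -> y' = seq_add z (shift m y') -> y = y'.
Proof.
  intros Hm H H'; apply functional_extensionality; intros n.
  induction n as [n IH] using lt_wf_ind.
  rewrite H, H'; unfold seq_add; rewrite !shift_val.
  destruct (Nat.leb_spec m n); [rewrite IH by lia|]; reflexivity.
Qed.

Lemma multiples_fix m : (0 < m)%nat ->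
  multiples m = seq_add unit_seq (shift m (multiples m)).
Proof.
  intros Hm; apply functional_extensionality; intros n.
  unfold seq_add; rewrite shift_val; unfold multiples.
  destruct (Nat.leb_spec m n) as [H|H].
  - replace (n mod m)%nat with ((n - m) mod m)%nat.
    + destruct n; [lia|]; unfold unit_seq; lra.
    + replace n with ((n - m) + 1 * m)%nat at 2 by lia.
      rewrite Nat.Div0.mod_add; reflexivity.
  - rewrite Nat.mod_small by lia; destruct n; simpl; ring.
Qed.

Lemma divq_fix m a : (0 < m)%nat -> divq m a = seq_add a (shift m (divq m a)).
Proof.
  intros Hm; unfold divq; rewrite (multiples_fix m Hm) at 1.
  rewrite conv_addl, conv_unitl, conv_shiftl; reflexivity.
Qed.

Lemma conv_divql m a b : (0 < m)%nat -> conv (divq m a) b = divq m (conv a b).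
Proof.
  intros Hm; apply (shift_fix_unique m (conv a b)); auto.
  - rewrite (divq_fix m a Hm) at 1; rewrite conv_addl, conv_shiftl; reflexivity.
  - apply divq_fix; auto.
Qed.

(** Coefficients of $mq^m/(1-q^m)$, the logarithmic derivative of $1/(1-q^m)$ for $q\,d/dq$. Index 0
    is set apart because [multiples m 0] is 1. For [m = 0] the sequence vanishes, so sums over [m]
    may start at 0. *)
Definition log_weight (m k : nat) : R :=
  match k with O => 0 | S _ => INR m * multiples m k end.

Lemma log_weight_fix m : (0 < m)%nat ->
  log_weight m = shift m (seq_add (scale (INR m) unit_seq) (log_weight m)).
Proof.
  intros Hm; apply functional_extensionality; intros n.
  rewrite shift_val; unfold seq_add, scale, log_weight.
  destruct (Nat.leb_spec m n) as [H|H].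
  - assert (E : multiples m n = unit_seq n + multiples m (n - m)).
    { generalize (f_equal (fun f => f n) (multiples_fix m Hm)).
      unfold seq_add; rewrite shift_val.
      destruct (Nat.leb_spec m n); [auto|lia]. }
    destruct n as [|n]; [lia|]; rewrite E.
    destruct (S n - m)%nat.
    + unfold multiples; rewrite Nat.Div0.mod_0_l; simpl; ring.
    + simpl; ring.
  - destruct n; [ring|]; unfold multiples; rewrite Nat.mod_small by lia; simpl; ring.
Qed.

(** The operator $q\,d/dq$; thus [euler a = conv s a] says that [s] is the logarithmic derivative of
    [a]. *)
Definition euler (a : nat -> R) (n : nat) : R := INR n * a n.

Lemma euler_shift m a :
  euler (shift m a) = seq_add (shift m (euler a)) (shift m (scale (INR m) a)).
Proof.
  apply functional_extensionality; intros n; unfold euler, seq_add.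
  rewrite !shift_val; unfold scale; destruct (Nat.leb_spec m n); [|ring].
  rewrite minus_INR by lia; ring.
Qed.

(* Logarithmic derivative of a quotient by [1 - q^m]: if [a] has logarithmic
   derivative [s], both [euler (divq m a)] and the claimed right-hand side are
   fixed by [y |-> euler a + m q^m divq m a + q^m y]. *)
Lemma euler_divq m s a : (0 < m)%nat -> euler a = conv s a ->
  euler (divq m a) = conv (seq_add s (log_weight m)) (divq m a).
Proof.
  intros Hm Ha; set (b := divq m a).
  assert (Hb : b = seq_add a (shift m b)) by (apply divq_fix; auto).
  apply (shift_fix_unique m
    (seq_add (euler a) (shift m (scale (INR m) b)))); auto.
  - rewrite Hb at 1.
    replace (euler (seq_add a (shift m b))) with (seq_add (euler a) (euler (shift m b)))
      by (apply functional_extensionality; intros; unfold euler, seq_add; ring).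
    rewrite euler_shift.
    apply functional_extensionality; intros; unfold seq_add; ring.
  - rewrite (conv_addl s (log_weight m)) at 1.
    rewrite Hb at 1; rewrite conv_addr, conv_shiftr, <- Ha.
    rewrite (log_weight_fix m Hm) at 1; rewrite conv_shiftl, conv_addl.
    rewrite conv_addl.
    rewrite conv_scalel, conv_unitl.
    apply functional_extensionality; intros n; unfold seq_add; rewrite !shift_val.
    destruct (m <=? n)%nat; ring.
Qed.

Definition nonneg (a : nat -> R) : Prop := forall n, 0 <= a n.

Lemma conv_nonneg a b : nonneg a -> nonneg b -> nonneg (conv a b).
Proof.
  intros Ha Hb n; apply cond_pos_sum; intros; apply Rmult_le_pos; auto.
Qed.

Lemma divq_nonneg m a : nonneg a -> nonneg (divq m a).
Proof.
  intros; apply conv_nonneg; auto.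
  intros k; unfold multiples; destruct (_ =? _)%nat; lra.
Qed.

Lemma divq_iter_conv j m a b : (0 < m)%nat ->
  conv (Nat.iter j (divq m) a) b = Nat.iter j (divq m) (conv a b).
Proof.
  intros Hm; induction j as [|j IH]; [reflexivity|]; simpl.
  rewrite conv_divql, IH by auto; reflexivity.
Qed.

Lemma divq_iter_nonneg j m a : nonneg a -> nonneg (Nat.iter j (divq m) a).
Proof. intros; induction j; simpl; auto using divq_nonneg. Qed.

Lemma euler_divq_iter j m s a : (0 < m)%nat -> euler a = conv s a ->
  euler (Nat.iter j (divq m) a) =
  conv (seq_add s (scale (INR j) (log_weight m))) (Nat.iter j (divq m) a).
Proof.
  intros Hm Ha; induction j as [|j IH].
  - simpl Nat.iter; rewrite Ha at 1; f_equal.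
    apply functional_extensionality; intros; unfold seq_add, scale; simpl; ring.
  - change (Nat.iter (S j) (divq m) a) with (divq m (Nat.iter j (divq m) a)).
    rewrite (euler_divq m _ _ Hm IH); f_equal.
    apply functional_extensionality; intros; unfold seq_add, scale.
    rewrite S_INR; ring.
Qed.

(* [prod_(m <= M) (1 - q^m)^(-24)]. *)
Fixpoint inv_delta (M : nat) : nat -> R :=
  match M with
  | O => unit_seq
  | S M' => Nat.iter 24 (divq M) (inv_delta M')
  end.

Lemma inv_delta_nonneg M : nonneg (inv_delta M).
Proof.
  induction M as [|M IH]; [intros [|n]; simpl; lra|].
  apply divq_iter_nonneg; auto.
Qed.

Lemma euler_inv_delta M :
  euler (inv_delta M) =
  conv (fun k => 24 * sum_f_R0 (fun m => log_weight m k) M) (inv_delta M).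
Proof.
  induction M as [|M IH].
  - apply functional_extensionality; intros n; unfold euler, conv.
    rewrite (sum_eq _ (fun _ => 0)), sum_cte.
    + destruct n; simpl; ring.
    + intros i _; unfold sum_f_R0, log_weight; destruct i; simpl; ring.
  - change (inv_delta (S M)) with (Nat.iter 24 (divq (S M)) (inv_delta M)).
    rewrite (euler_divq_iter 24 (S M) _ _ (Nat.lt_0_succ M) IH).
    f_equal.
    apply functional_extensionality; intros k; unfold seq_add, scale.
    rewrite tech5; simpl INR; ring.
Qed.

Definition sigma1 (k : nat) : R := sum_f_R0 (fun m => log_weight m k) k.

(** No divisor of $k>0$ exceeds $k$, so the weights of index at most [M] do not feel the truncation
    of the product at [M]. *)
Lemma sigma1_stable M k : (k <= M)%nat ->
  sum_f_R0 (fun m => log_weight m k) M = sigma1 k.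
Proof.
  induction 1 as [|M HM IH]; [reflexivity|].
  rewrite tech5, IH; unfold log_weight; destruct k as [|k]; [ring|].
  unfold multiples; rewrite Nat.mod_small by lia; simpl; ring.
Qed.

Lemma divq1_succ a n : divq 1 a (S n) = a (S n) + divq 1 a n.
Proof. exact (f_equal (fun f => f (S n)) (divq_fix 1 a Nat.lt_0_1)). Qed.

Lemma divq1_0 a : divq 1 a 0 = a 0%nat.
Proof. unfold divq, conv, multiples; simpl; ring. Qed.

Lemma divq1_4_unit n :
  Nat.iter 4 (divq 1) unit_seq n = (INR n + 1) * (INR n + 2) * (INR n + 3) / 6.
Proof.
  assert (H1 : forall n, divq 1 unit_seq n = 1).
  { induction n0 as [|k IH]; [rewrite divq1_0; reflexivity|].
    rewrite divq1_succ, IH; simpl; ring. }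
  assert (H2 : forall n, divq 1 (divq 1 unit_seq) n = INR n + 1).
  { induction n0 as [|k IH]; [rewrite divq1_0, H1; simpl; ring|].
    rewrite divq1_succ, IH, H1, S_INR; ring. }
  assert (H3 : forall n, divq 1 (divq 1 (divq 1 unit_seq)) n
     = (INR n + 1) * (INR n + 2) / 2).
  { induction n0 as [|k IH]; [rewrite divq1_0, H2; simpl; field|].
    rewrite divq1_succ, IH, H2, S_INR; field. }
  simpl; induction n as [|k IH]; [rewrite divq1_0, H3; simpl; field|].
  rewrite divq1_succ, IH, H3, S_INR; field.
Qed.

(** * The value of zeta(2) *)

(** Takes the place of integration: sums are compared with explicit primitives, and elementary
    inequalities are obtained by differentiating until the sign is evident. *)
Lemma derive_le (f g df dg : R -> R) a b : a <= b ->
  (forall t, a <= t <= b -> is_derive f t (df t)) ->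
  (forall t, a <= t <= b -> is_derive g t (dg t)) ->
  (forall t, a <= t <= b -> df t <= dg t) ->
  f b - f a <= g b - g a.
Proof.
  intros Hab Hf Hg Hle.
  destruct (MVT_gen (fun t => g t - f t) a b (fun t => dg t - df t)) as [c [Hc E]].
  - intros t Ht; rewrite Rmin_left, Rmax_right in Ht by lra.
    apply (is_derive_minus (V := R_NormedModule)); [apply Hg|apply Hf]; lra.
  - intros t Ht; rewrite Rmin_left, Rmax_right in Ht by lra.
    apply continuity_pt_filterlim, (ex_derive_continuous (fun t => g t - f t)).
    exists (dg t - df t).
    apply (is_derive_minus (V := R_NormedModule)); [apply Hg|apply Hf]; lra.
  - rewrite Rmin_left, Rmax_right in Hc by lra.
    assert (0 <= (dg c - df c) * (b - a)).
    { apply Rmult_le_pos; [|lra]. specialize (Hle c Hc); lra. }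
    lra.
Qed.

Lemma derive_nonneg (f df : R -> R) a b : a <= b ->
  (forall t, a <= t <= b -> is_derive f t (df t)) ->
  (forall t, a <= t <= b -> 0 <= df t) -> f a <= f b.
Proof.
  intros Hab Hf Hp.
  enough (0 - 0 <= f b - f a) by lra.
  apply (derive_le (fun _ => 0) f (fun _ => 0) df); auto.
  intros; apply (is_derive_const (V := R_NormedModule)).
Qed.

Lemma sum_f_R0_rev f n : sum_f_R0 (fun k => f (n - k)%nat) n = sum_f_R0 f n.
Proof.
  induction n as [|n IH]; [reflexivity|].
  rewrite decomp_sum by lia; rewrite Nat.sub_0_r, (tech5 f n), Rplus_comm.
  f_equal; exact IH.
Qed.

Lemma sum_f_R0_fold f m : (0 < m)%nat ->
  sum_f_R0 f (2 * m) =
  sum_f_R0 (fun k => f k + f (2 * m - k)%nat) (m - 1) + f m.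
Proof.
  intros Hm; rewrite (tech2 f m (2 * m)) by lia.
  replace m with (S (m - 1)) at 1 by lia; rewrite tech5.
  replace (S (m - 1)) with m by lia.
  rewrite sum_plus.
  rewrite <- (sum_f_R0_rev (fun i => f (S m + i)%nat)).
  replace (2 * m - S m)%nat with (m - 1)%nat by lia.
  rewrite (sum_eq (fun k => f (S m + (m - 1 - k))%nat) (fun k => f (2 * m - k)%nat)).
  - ring.
  - intros i Hi; f_equal; lia.
Qed.

Definition inv_sin_sq (N k : nat) : R := / (sin (INR (S k) * PI / (2 * INR N))) ^ 2.

(** $\sin^{-2}+\cos^{-2}=(\sin\cos)^{-2}$ at $t/2$, and $\sin(t/2)\cos(t/2)=\frac12\sin t$. *)
Lemma inv_sin_sq_double t : 0 < t < PI / 2 ->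
  / (sin (t / 2)) ^ 2 + / (sin (PI / 2 - t / 2)) ^ 2 = 4 * / (sin t) ^ 2.
Proof.
  intros Ht; rewrite sin_shift.
  assert (H1 : 0 < sin (t / 2)) by (apply sin_gt_0; lra).
  assert (H2 : 0 < cos (t / 2)) by (apply cos_gt_0; lra).
  replace t with (2 * (t / 2)) at 3 by field; rewrite sin_2a.
  generalize (sin2_cos2 (t / 2)); unfold Rsqr; intros E.
  replace (/ sin (t / 2) ^ 2 + / cos (t / 2) ^ 2) with
    ((sin (t/2) * sin (t/2) + cos (t/2) * cos (t/2)) / (sin (t / 2) ^ 2 * cos (t / 2) ^ 2))
    by (field; lra).
  rewrite E; field; lra.
Qed.

(** Doubling $N$ pairs the angles $t/2$ and $\pi/2-t/2$, where $t$ runs through the angles for $N$,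
    and leaves $\pi/4$ alone; hence $S(2N)=4S(N)+2$. Powers of two suffice to reach $\zeta(2)$. *)
Lemma sum_inv_sin_sq n :
  sum_f_R0 (inv_sin_sq (2 ^ S n)) (2 ^ S n - 2) = (2 * INR (2 ^ S n) ^ 2 - 2) / 3.
Proof.
  induction n as [|n IH].
  - simpl sum_f_R0; unfold inv_sin_sq; simpl INR.
    replace (1 * PI / (2 * (1 + 1))) with (PI / 4) by field.
    rewrite sin_PI4.
    assert (0 < sqrt 2) by (apply sqrt_lt_R0; lra).
    replace ((1 / sqrt 2) ^ 2) with (/ (sqrt 2 * sqrt 2)) by (field; lra).
    rewrite sqrt_sqrt by lra; field.
  - set (N := (2 ^ S n)%nat) in *.
    assert (HN : (2 <= N)%nat).
    { unfold N; simpl; generalize (Nat.neq_0_le_1 (2 ^ n)).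
      generalize (Nat.pow_nonzero 2 n); lia. }
    replace (2 ^ S (S n))%nat with (2 * N)%nat by (unfold N; simpl; lia).
    replace (2 * N - 2)%nat with (2 * (N - 1))%nat by lia.
    rewrite sum_f_R0_fold by lia.
    assert (HR : 2 <= INR N) by (apply (le_INR 2); lia).
    assert (HP := PI_RGT_0).
    rewrite (sum_eq _ (fun k => inv_sin_sq N k * 4)).
    + rewrite <- scal_sum.
      replace (N - 1 - 1)%nat with (N - 2)%nat by lia.
      rewrite IH; unfold inv_sin_sq.
      replace (S (N - 1)) with N by lia.
      rewrite !mult_INR; change (INR 2) with 2.
      replace (INR N * PI / (2 * (2 * INR N))) with (PI / 4) by (field; lra).
      rewrite sin_PI4.
      assert (0 < sqrt 2) by (apply sqrt_lt_R0; lra).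
      replace ((1 / sqrt 2) ^ 2) with (/ (sqrt 2 * sqrt 2)) by (field; lra).
      rewrite sqrt_sqrt by lra; field.
    + intros k Hk; unfold inv_sin_sq.
      assert (HkR : INR (S k) <= INR N - 1).
      { replace 1 with (INR 1) by reflexivity; rewrite <- minus_INR by lia.
        apply le_INR; lia. }
      assert (Hk0 : 1 <= INR (S k)) by (apply (le_INR 1); lia).
      set (t := INR (S k) * PI / (2 * INR N)).
      assert (Ht : 0 < t < PI / 2).
      { unfold t; split.
        - apply Rdiv_lt_0_compat; nra.
        - apply Rmult_lt_reg_r with (2 * INR N); [lra|].
          replace (INR (S k) * PI / (2 * INR N) * (2 * INR N)) with (INR (S k) * PI)
            by (field; lra).
          nra. }
      rewrite (Rmult_comm _ 4), <- (inv_sin_sq_double t Ht).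
      f_equal; do 3 f_equal; rewrite mult_INR; change (INR 2) with 2; unfold t.
      * field; lra.
      * replace (S (2 * (N - 1) - k))%nat with (2 * N - S k)%nat by lia.
        rewrite minus_INR, mult_INR by lia; change (INR 2) with 2; field; lra.
Qed.

Lemma x_cos_le_sin x : 0 <= x -> x * cos x <= sin x \/ PI / 2 < x.
Proof.
  intros Hx; destruct (Rle_dec x (PI / 2)) as [H|H]; [left|right; lra].
  enough (sin 0 - 0 * cos 0 <= sin x - x * cos x) by (rewrite sin_0 in H0; lra).
  apply (derive_nonneg (fun t => sin t - t * cos t) (fun t => t * sin t)); auto.
  - intros t _; auto_derive; [auto|ring].
  - intros t Ht; apply Rmult_le_pos; [lra|]; apply sin_ge_0; lra.
Qed.

(** Since $1/\sin^2x-1=\cot^2x$, this is $\sin x\le x\le\tan x$ squared and inverted. Summed over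
    $x=k\pi/(2N)$ it squeezes $\zeta(2)$. *)
Lemma inv_sq_between x : 0 < x < PI / 2 ->
  / (sin x) ^ 2 - 1 <= / x ^ 2 <= / (sin x) ^ 2.
Proof.
  intros Hx.
  assert (Hs : 0 < sin x) by (apply sin_gt_0; lra).
  assert (Hc : 0 < cos x) by (apply cos_gt_0; lra).
  assert (H1 : sin x < x) by (apply sin_lt_x; lra).
  destruct (x_cos_le_sin x) as [H2|H2]; [lra| |lra].
  generalize (sin2_cos2 x); unfold Rsqr; intros E.
  split.
  - replace (/ sin x ^ 2 - 1) with ((cos x / sin x) ^ 2)
      by (field_simplify; [|lra|lra]; f_equal; nra).
    replace (/ x ^ 2) with ((/ x) ^ 2) by (field; lra).
    apply pow_incr; split.
    + apply Rlt_le, Rdiv_lt_0_compat; lra.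
    + apply Rmult_le_reg_r with (x * sin x); [nra|].
      replace (cos x / sin x * (x * sin x)) with (x * cos x) by (field; lra).
      replace (/ x * (x * sin x)) with (sin x) by (field; lra); lra.
  - apply Rinv_le_contravar; [nra|]; apply pow_incr; lra.
Qed.

Definition zeta2 (J : nat) : R := sum_f_R0 (fun j => / INR (S j) ^ 2) J.

Lemma zeta2_bounds n : let N := INR (2 ^ S n) in
  PI ^ 2 / 6 - PI ^ 2 / (4 * N) <= zeta2 (2 ^ S n - 2) <= PI ^ 2 / 6.
Proof.
  intros N; assert (HP := PI_RGT_0).
  assert (Hn : (2 <= 2 ^ S n)%nat).
  { simpl; generalize (Nat.pow_nonzero 2 n); lia. }
  assert (HN : 2 <= N) by (apply (le_INR 2); exact Hn).
  assert (B : forall k, (k <= 2 ^ S n - 2)%nat ->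
     inv_sin_sq (2 ^ S n) k - 1 <= / INR (S k) ^ 2 * (4 * N ^ 2 / PI ^ 2)
       <= inv_sin_sq (2 ^ S n) k).
  { intros k Hk; fold N.
    assert (Hk0 : 1 <= INR (S k)) by (apply (le_INR 1); lia).
    assert (HkR : INR (S k) <= N - 1).
    { unfold N; replace 1 with (INR 1) by reflexivity; rewrite <- minus_INR by lia.
      apply le_INR; lia. }
    replace (/ INR (S k) ^ 2 * (4 * N ^ 2 / PI ^ 2)) with
      (/ (INR (S k) * PI / (2 * N)) ^ 2) by (field; lra).
    apply inv_sq_between; split.
    - apply Rdiv_lt_0_compat; nra.
    - apply Rmult_lt_reg_r with (2 * N); [lra|].
      replace (INR (S k) * PI / (2 * N) * (2 * N)) with (INR (S k) * PI) by (field; lra).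
      nra. }
  assert (E := sum_inv_sin_sq n); fold N in E.
  assert (U : zeta2 (2 ^ S n - 2) * (4 * N ^ 2 / PI ^ 2) <= (2 * N ^ 2 - 2) / 3).
  { rewrite <- E; unfold zeta2; rewrite Rmult_comm, scal_sum; apply sum_Rle.
    intros k Hk; apply B; auto. }
  assert (L : (2 * N ^ 2 - 2) / 3 - (N - 1) <= zeta2 (2 ^ S n - 2) * (4 * N ^ 2 / PI ^ 2)).
  { rewrite <- E; unfold zeta2; rewrite (Rmult_comm (sum_f_R0 _ _)), scal_sum.
    replace (N - 1) with (sum_f_R0 (fun _ => 1) (2 ^ S n - 2)).
    - rewrite <- minus_sum; apply sum_Rle; intros k Hk; apply B; auto.
    - rewrite sum_cte; replace (S (2 ^ S n - 2)) with (2 ^ S n - 1)%nat by lia.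
      rewrite minus_INR by lia; fold N; simpl; ring. }
  set (z := zeta2 _) in *.
  replace z with (z * (4 * N ^ 2 / PI ^ 2) * (PI ^ 2 / (4 * N ^ 2))) by (field; lra).
  assert (HC : 0 < PI ^ 2 / (4 * N ^ 2)) by (apply Rdiv_lt_0_compat; nra).
  split.
  - apply Rle_trans with (((2 * N ^ 2 - 2) / 3 - (N - 1)) * (PI ^ 2 / (4 * N ^ 2))).
    + replace (((2 * N ^ 2 - 2) / 3 - (N - 1)) * (PI ^ 2 / (4 * N ^ 2))) with
        (PI ^ 2 / 6 - PI ^ 2 / (4 * N) + PI ^ 2 / (4 * N ^ 2) / 3) by (field; lra).
      lra.
    + apply Rmult_le_compat_r; lra.
  - apply Rle_trans with ((2 * N ^ 2 - 2) / 3 * (PI ^ 2 / (4 * N ^ 2))).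
    + apply Rmult_le_compat_r; lra.
    + replace ((2 * N ^ 2 - 2) / 3 * (PI ^ 2 / (4 * N ^ 2))) with
        (PI ^ 2 / 6 - PI ^ 2 / (4 * N ^ 2) * (2 / 3)) by (field; lra).
      lra.
Qed.

Lemma pow2_ge n : (n < 2 ^ n)%nat.
Proof. apply Nat.pow_gt_lin_r; lia. Qed.

Lemma zeta2_le J : zeta2 J <= PI ^ 2 / 6.
Proof.
  destruct (zeta2_bounds (S J)) as [_ H].
  apply Rle_trans with (2 := H).
  assert (HJ : (J <= 2 ^ S (S J) - 2)%nat).
  { generalize (pow2_ge J); simpl; lia. }
  revert HJ; generalize (2 ^ S (S J) - 2)%nat; induction 1 as [|K HK IH]; [lra|].
  unfold zeta2 in *; rewrite tech5.
  assert (0 < / INR (S (S K)) ^ 2).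
  { apply Rinv_0_lt_compat, pow_lt, lt_0_INR; lia. }
  lra.
Qed.

Lemma zeta2_ge eps : 0 < eps -> exists J, PI ^ 2 / 6 - eps <= zeta2 J.
Proof.
  intros He.
  assert (HP := PI_RGT_0).
  destruct (nfloor_ex (PI ^ 2 / (4 * eps))) as [n Hn].
  { apply Rlt_le, Rdiv_lt_0_compat; nra. }
  exists (2 ^ S n - 2)%nat.
  destruct (zeta2_bounds n) as [H _].
  apply Rle_trans with (2 := H).
  set (N := INR (2 ^ S n)).
  assert (HN : INR n + 1 <= N).
  { unfold N; rewrite <- S_INR; apply le_INR; generalize (pow2_ge n); simpl; lia. }
  assert (0 <= INR n) by apply pos_INR.
  enough (PI ^ 2 / (4 * N) <= eps) by lra.
  apply Rmult_le_reg_r with (N / eps); [apply Rdiv_lt_0_compat; lra|].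
  replace (PI ^ 2 / (4 * N) * (N / eps)) with (PI ^ 2 / (4 * eps)) by (field; lra).
  replace (eps * (N / eps)) with N by (field; lra); lra.
Qed.

(** * Lambert series near the cusp *)

(* Rocq's division gives [phi 0 = 0]; the limit there is [1]. *)
Definition phi (y : R) : R := y / (exp y - 1).
(** The series to be estimated is $\sum_m m/(e^{mx}-1)=x^{-1}\sum_m\phi(mx)$, essentially a Riemann
    sum of mesh $x$. The signs of the derivatives of [phi] decide the direction of the quadrature
    errors. *)
Definition dphi (y : R) : R := (exp y - 1 - y * exp y) / (exp y - 1) ^ 2.
Definition ddphi (y : R) : R :=
  exp y * (y * (exp y + 1) - 2 * (exp y - 1)) / (exp y - 1) ^ 3.
Definition dddphi (y : R) : R :=
  - (exp y * (y * (exp y ^ 2 + 4 * exp y + 1) - 3 * (exp y ^ 2 - 1)) / (exp y - 1) ^ 4).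

Lemma exp_gt_1 y : 0 < y -> 0 < exp y - 1.
Proof. intros; generalize (exp_ineq1 y); lra. Qed.

Lemma is_derive_phi y : 0 < y -> is_derive phi y (dphi y).
Proof.
  intros Hy; generalize (exp_gt_1 y Hy); intros.
  unfold phi, dphi; auto_derive; [lra|field; lra].
Qed.

Lemma is_derive_dphi y : 0 < y -> is_derive dphi y (ddphi y).
Proof.
  intros Hy; generalize (exp_gt_1 y Hy); intros.
  unfold dphi, ddphi; auto_derive; [apply Rgt_not_eq; nra|field; lra].
Qed.

Lemma is_derive_ddphi y : 0 < y -> is_derive ddphi y (dddphi y).
Proof.
  intros Hy; generalize (exp_gt_1 y Hy); intros.
  unfold ddphi, dddphi; auto_derive.
  - apply Rgt_not_eq; assert (0 < (exp y - 1) ^ 3) by (apply pow_lt; lra); simpl in *; lra.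
  - field; lra.
Qed.

Lemma phi_num2_nonneg y : 0 <= y -> 0 <= y * (exp y + 1) - 2 * (exp y - 1).
Proof.
  intros Hy.
  assert (H : forall t, 0 <= t -> 0 <= 1 + t * exp t - exp t).
  { intros t Ht.
    enough (1 + 0 * exp 0 - exp 0 <= 1 + t * exp t - exp t) by (rewrite exp_0 in H; lra).
    apply (derive_nonneg (fun t => 1 + t * exp t - exp t) (fun t => t * exp t)); auto.
    - intros u _; auto_derive; [auto|ring].
    - intros u Hu; apply Rmult_le_pos; [lra|]; apply Rlt_le, exp_pos. }
  enough (0 * (exp 0 + 1) - 2 * (exp 0 - 1) <= y * (exp y + 1) - 2 * (exp y - 1))
    by (rewrite exp_0 in H0; lra).
  apply (derive_nonneg (fun t => t * (exp t + 1) - 2 * (exp t - 1))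
     (fun t => 1 + t * exp t - exp t)); auto.
  - intros u _; auto_derive; [auto|ring].
  - intros u Hu; apply H; lra.
Qed.

(** Two differentiations lead back to [phi_num2_nonneg]: the derivative is the expression in [H],
    whose derivative is $4e^t(t(e^t+1)-2(e^t-1))$, and both functions vanish at 0. *)
Lemma phi_num3_nonneg y : 0 <= y ->
  0 <= y * (exp y ^ 2 + 4 * exp y + 1) - 3 * (exp y ^ 2 - 1).
Proof.
  intros Hy.
  assert (H : forall t, 0 <= t ->
    0 <= - 5 * exp t ^ 2 + 4 * exp t + 1 + t * (2 * exp t ^ 2 + 4 * exp t)).
  { intros t Ht.
    replace 0 with (- 5 * exp 0 ^ 2 + 4 * exp 0 + 1 + 0 * (2 * exp 0 ^ 2 + 4 * exp 0))
      by (rewrite exp_0; ring).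
    apply (derive_nonneg
      (fun t => - 5 * exp t ^ 2 + 4 * exp t + 1 + t * (2 * exp t ^ 2 + 4 * exp t))
      (fun t => 4 * exp t * (t * (exp t + 1) - 2 * (exp t - 1)))); auto.
    - intros u _; auto_derive; [auto|ring].
    - intros u Hu; apply Rmult_le_pos; [generalize (exp_pos u); lra|].
      apply phi_num2_nonneg; lra. }
  replace 0 with (0 * (exp 0 ^ 2 + 4 * exp 0 + 1) - 3 * (exp 0 ^ 2 - 1))
    by (rewrite exp_0; ring).
  apply (derive_nonneg (fun y => y * (exp y ^ 2 + 4 * exp y + 1) - 3 * (exp y ^ 2 - 1))
    (fun t => - 5 * exp t ^ 2 + 4 * exp t + 1 + t * (2 * exp t ^ 2 + 4 * exp t))); auto.
  - intros u _; auto_derive; [auto|ring].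
  - intros u Hu; apply H; lra.
Qed.

Lemma ddphi_nonneg y : 0 < y -> 0 <= ddphi y.
Proof.
  intros Hy; unfold ddphi, Rdiv; repeat apply Rmult_le_pos.
  - apply Rlt_le, exp_pos.
  - apply phi_num2_nonneg; lra.
  - apply Rlt_le, Rinv_0_lt_compat, pow_lt, exp_gt_1; auto.
Qed.

Lemma ddphi_decr a b : 0 < a <= b -> ddphi b <= ddphi a.
Proof.
  intros H; enough (- ddphi a <= - ddphi b) by lra.
  apply (derive_nonneg (fun t => - ddphi t) (fun t => - dddphi t)); [lra| |].
  - intros t Ht; apply (is_derive_opp (V := R_NormedModule)), is_derive_ddphi; lra.
  - intros t Ht; unfold dddphi; rewrite Ropp_involutive.
    unfold Rdiv; repeat apply Rmult_le_pos.
    + apply Rlt_le, exp_pos.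
    + apply phi_num3_nonneg; lra.
    + apply Rlt_le, Rinv_0_lt_compat, pow_lt, exp_gt_1; lra.
Qed.

Lemma dphi_incr a b : 0 < a <= b -> dphi a <= dphi b.
Proof.
  intros H; apply (derive_nonneg dphi ddphi); [lra| |].
  - intros; apply is_derive_dphi; lra.
  - intros; apply ddphi_nonneg; lra.
Qed.

Lemma phi_pos y : 0 < y -> 0 < phi y.
Proof. intros; apply Rdiv_lt_0_compat; auto using exp_gt_1. Qed.

Lemma phi_le_1 y : 0 < y -> phi y <= 1.
Proof.
  intros Hy; unfold phi; generalize (exp_ineq1 y); intros.
  apply Rmult_le_reg_r with (exp y - 1); [lra|].
  unfold Rdiv; rewrite Rmult_assoc, Rinv_l; lra.
Qed.

Lemma phi_ge y : 0 < y -> 1 - y / 2 <= phi y.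
Proof.
  intros Hy; unfold phi; generalize (exp_gt_1 y Hy) (phi_num2_nonneg y); intros.
  apply Rmult_le_reg_r with (exp y - 1); [lra|].
  unfold Rdiv at 2; rewrite Rmult_assoc, Rinv_l; nra.
Qed.

(* A truncation of the primitive of [phi] that vanishes at infinity, from
   [phi y = sum_(j >= 1) y exp (- j y)]. *)
Definition lambert_primitive (J : nat) (y : R) : R :=
  sum_f_R0 (fun j => - (exp (- (INR (S j) * y)) * (1 + INR (S j) * y) / INR (S j) ^ 2)) J.

Definition lambert_partial (J : nat) (y : R) : R :=
  sum_f_R0 (fun j => y * exp (- (INR (S j) * y))) J.

Lemma is_derive_lambert_term (r y : R) : 0 < r ->
  is_derive (fun y => - (exp (- (r * y)) * (1 + r * y) / r ^ 2)) y (y * exp (- (r * y))).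
Proof. intros Hr; auto_derive; [auto|field; lra]. Qed.

Lemma is_derive_lambert_primitive J y :
  is_derive (lambert_primitive J) y (lambert_partial J y).
Proof.
  induction J as [|J IH].
  - apply (is_derive_lambert_term (INR 1)); apply lt_0_INR; lia.
  - apply (is_derive_plus (V := R_NormedModule) (lambert_primitive J)); [exact IH|].
    apply is_derive_lambert_term, lt_0_INR; lia.
Qed.

Lemma lambert_partial_val J y : 0 < y ->
  lambert_partial J y = phi y * (1 - exp (- (INR (S J) * y))).
Proof.
  intros Hy; generalize (exp_gt_1 y Hy); intros HE.
  unfold lambert_partial, phi.
  induction J as [|J IH].
  - unfold sum_f_R0; change (INR 1) with 1; rewrite (Rmult_1_l y), exp_Ropp; field.
    generalize (exp_pos y); lra.
  - rewrite tech5, IH, (S_INR (S J)), !Rmult_plus_distr_r, Rmult_1_l.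
    rewrite Ropp_plus_distr, exp_plus, (exp_Ropp y).
    field; generalize (exp_pos y); lra.
Qed.

Lemma lambert_partial_le J y : 0 < y -> lambert_partial J y <= phi y.
Proof.
  intros Hy; rewrite lambert_partial_val by auto.
  generalize (phi_pos y Hy) (exp_pos (- (INR (S J) * y))); nra.
Qed.

(** The point where $\zeta(2)$ enters: the integral of [phi] over $(0,\infty)$ is $\sum_j 1/j^2$,
    here truncated. *)
Lemma lambert_primitive_0 J : lambert_primitive J 0 = - zeta2 J.
Proof.
  unfold lambert_primitive, zeta2.
  replace (- sum_f_R0 (fun j => / INR (S j) ^ 2) J) with
    ((-1) * sum_f_R0 (fun j => / INR (S j) ^ 2) J) by ring.
  rewrite scal_sum; apply sum_eq; intros j _.
  rewrite Rmult_0_r, Ropp_0, exp_0, Rplus_0_r; unfold Rdiv; ring.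
Qed.

Lemma lambert_primitive_nonpos J y : 0 <= y -> lambert_primitive J y <= 0.
Proof.
  intros Hy; unfold lambert_primitive.
  replace 0 with (sum_f_R0 (fun _ => 0) J) by (rewrite sum_cte; ring).
  apply sum_Rle; intros j _.
  assert (0 < INR (S j)) by (apply lt_0_INR; lia).
  enough (0 <= exp (- (INR (S j) * y)) * (1 + INR (S j) * y) / INR (S j) ^ 2) by lra.
  apply Rmult_le_pos; [apply Rmult_le_pos|].
  - apply Rlt_le, exp_pos.
  - nra.
  - apply Rlt_le, Rinv_0_lt_compat, pow_lt; auto.
Qed.

Lemma exp_ge_quad u : 0 <= u -> 1 + u + u ^ 2 / 2 <= exp u.
Proof.
  intros Hu.
  enough (exp 0 - (1 + 0 + 0 ^ 2 / 2) <= exp u - (1 + u + u ^ 2 / 2))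
    by (rewrite exp_0 in H; lra).
  apply (derive_nonneg (fun u => exp u - (1 + u + u ^ 2 / 2)) (fun u => exp u - (1 + u))); auto.
  - intros t _; auto_derive; [auto|field].
  - intros t _; generalize (exp_ineq1_le t); lra.
Qed.

(** A crude decay that is not uniform in [J]; it is enough because [J] is fixed before the endpoint
    [y] is sent to infinity. *)
Lemma lambert_primitive_ge J y : 0 < y ->
  - (2 * INR (S J) / y) <= lambert_primitive J y.
Proof.
  intros Hy; unfold lambert_primitive.
  replace (- (2 * INR (S J) / y)) with (sum_f_R0 (fun _ => - (2 / y)) J)
    by (rewrite sum_cte; field; lra).
  apply sum_Rle; intros j _; apply Ropp_le_contravar.
  assert (Hj : 1 <= INR (S j)) by (apply (le_INR 1); lia).
  set (r := INR (S j)) in *; rewrite exp_Ropp.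
  assert (0 < r * y) by nra.
  generalize (exp_ge_quad (r * y)) (exp_pos (r * y)); intros H1 H2.
  apply Rmult_le_reg_r with (exp (r * y) * r ^ 2 * y);
    [apply Rmult_lt_0_compat; [apply Rmult_lt_0_compat; nra|lra]|].
  replace (/ exp (r * y) * (1 + r * y) / r ^ 2 * (exp (r * y) * r ^ 2 * y))
    with (y * (1 + r * y)) by (field; lra).
  replace (2 / y * (exp (r * y) * r ^ 2 * y)) with (2 * r ^ 2 * exp (r * y)) by (field; lra).
  apply Rle_trans with (2 * r ^ 2 * (1 + r * y + (r * y) ^ 2 / 2)).
  - assert (y * r ^ 2 * r >= y) by (assert (1 <= r ^ 2 * r) by nra; nra).
    assert (y ^ 2 * r <= y ^ 2 * r ^ 4).
    { apply Rmult_le_compat_l; [nra|]. assert (1 <= r ^ 3) by (apply pow_R1_Rle; lra). nra. }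
    nra.
  - apply Rmult_le_compat_l; [nra|]; apply H1; lra.
Qed.

Lemma dphi_ge y : 0 < y -> - (3 / y) <= dphi y.
Proof.
  intros Hy; unfold dphi.
  generalize (exp_ge_quad y (Rlt_le _ _ Hy)) (exp_gt_1 y Hy); intros H HE.
  set (E := exp y) in *.
  assert (H' : y + y ^ 2 / 2 <= E - 1) by lra.
  set (D := E - 1) in *; replace E with (D + 1) by (unfold D; ring).
  apply Rmult_le_reg_r with (D ^ 2 * y);
    [apply Rmult_lt_0_compat; [apply pow_lt|]; lra|].
  replace ((D - y * (D + 1)) / D ^ 2 * (D ^ 2 * y)) with (y * (D - y * (D + 1)))
    by (field; lra).
  replace (- (3 / y) * (D ^ 2 * y)) with (- 3 * D ^ 2) by (field; lra).
  assert (y ^ 2 <= D ^ 2) by (apply pow_incr; nra).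
  assert (y ^ 2 * D <= 2 * D * D) by (apply Rmult_le_compat_r; nra).
  assert (0 <= y * D) by (apply Rmult_le_pos; lra).
  replace (y * (D - y * (D + 1))) with (y * D - y ^ 2 * D - y ^ 2) by ring.
  replace (-3 * D ^ 2) with (- (2 * D * D) - D ^ 2) by ring.
  lra.
Qed.

(* Trapezoid rule: the error is at least that of the parabola with second
   derivative [ddphi b], the minimum of [ddphi] on the cell. *)
Lemma trapezoid_cell J a b : 0 < a <= b ->
  lambert_primitive J b - lambert_primitive J a <=
  (b - a) * (phi a + phi b) / 2 - (b - a) ^ 3 * ddphi b / 12.
Proof.
  intros Hab; set (P := ddphi b).
  enough (lambert_primitive J b - lambert_primitive J a <=
     ((b - a) * (phi a + phi b) / 2 - (b - a) ^ 3 * P / 12) -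
     ((a - a) * (phi a + phi a) / 2 - (a - a) ^ 3 * P / 12)) by lra.
  apply (derive_le (lambert_primitive J)
    (fun t => (t - a) * (phi a + phi t) / 2 - (t - a) ^ 3 * P / 12)
    (lambert_partial J)
    (fun t => (phi a + phi t) / 2 + (t - a) * dphi t / 2 - (t - a) ^ 2 * P / 4)).
  - lra.
  - intros; apply is_derive_lambert_primitive.
  - intros t Ht.
    assert (D := is_derive_phi t ltac:(lra)).
    auto_derive.
    + eexists; exact D.
    + rewrite (is_derive_unique (fun x : R => phi x) t (dphi t) D); field.
  - intros t Ht; apply Rle_trans with (phi t); [apply lambert_partial_le; lra|].
    (* This expression vanishes at $t=a$, and its derivative is $(t-a)(\phi''(t)-P)$ with
       $\phi''(t)\ge P$. *)
    enough (0 <= (t - a) * dphi t - (phi t - phi a) - (t - a) ^ 2 * P / 2) by lra.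
    replace 0 with ((a - a) * dphi a - (phi a - phi a) - (a - a) ^ 2 * P / 2) by field.
    apply (derive_nonneg (fun t => (t - a) * dphi t - (phi t - phi a) - (t - a) ^ 2 * P / 2)
      (fun t => (t - a) * (ddphi t - P))); [lra| |].
    + intros u Hu.
      assert (D := is_derive_phi u ltac:(lra)).
      assert (D' := is_derive_dphi u ltac:(lra)).
      auto_derive.
      * repeat split; eexists; eassumption.
      * rewrite (is_derive_unique (fun x : R => phi x) u (dphi u) D).
        rewrite (is_derive_unique (fun x : R => dphi x) u (ddphi u) D').
        field.
    + intros u Hu; apply Rmult_le_pos; [lra|].
      generalize (ddphi_decr u b); unfold P; lra.
Qed.

(** The cell $[0,x]$ is a limit of the cells $[d,x]$ with $d\to0$, for which $\phi(d)\le1$. The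
    limit value 1 has to be written out, since [phi 0] is 0; continuity is only asked of [H], which
    does not contain $\phi(d)$. *)
Lemma trapezoid_first_cell J x : 0 < x ->
  lambert_primitive J x - lambert_primitive J 0 <=
  x * (1 + phi x) / 2 - x ^ 3 * ddphi x / 12.
Proof.
  intros Hx.
  set (H := fun d => (x - d) * (1 + phi x) / 2 - (x - d) ^ 3 * ddphi x / 12 -
     (lambert_primitive J x - lambert_primitive J d)).
  enough (0 <= H 0) by (unfold H in H0; rewrite !Rminus_0_r in H0; lra).
  assert (HC : continuity_pt H 0).
  { apply continuity_pt_filterlim, (ex_derive_continuous H).
    unfold H; auto_derive; eexists; apply is_derive_lambert_primitive. }
  assert (Hd : forall d, 0 < d < x -> 0 <= H d).
  { intros d Hd; unfold H.
    generalize (trapezoid_cell J d x ltac:(lra)) (phi_le_1 d (proj1 Hd)).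
    nra. }
  destruct (Rle_dec 0 (H 0)) as [?|Hn]; [auto|exfalso].
  destruct (HC (- H 0) ltac:(lra)) as [al [Hal Hc]].
  set (d := Rmin (al / 2) (x / 2)).
  assert (0 < d < x /\ d < al).
  { unfold d; split; [split|].
    - apply Rmin_glb_lt; lra.
    - apply Rle_lt_trans with (1 := Rmin_r _ _); lra.
    - apply Rle_lt_trans with (1 := Rmin_l _ _); lra. }
  specialize (Hc d); simpl in Hc; unfold R_dist in Hc.
  assert (Rabs (H d - H 0) < - H 0).
  { apply Hc; split; [split; [exact I|lra]|].
    rewrite Rminus_0_r, Rabs_pos_eq; lra. }
  specialize (Hd d ltac:(lra)).
  rewrite Rabs_pos_eq in H1; lra.
Qed.

Lemma phi_0 : phi 0 = 0.
Proof. unfold phi; lra. Qed.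

(** The trapezoid rule summed over the cells, with the half weight $x/2$ of the endpoint 0 moved to
    the left because [phi 0] is 0. By [G] the second-order corrections dominate a telescoping sum of
    differences of [dphi]; its initial term $-\phi'(x)\approx1/2$ yields the $x^2/24$ of the
    Euler-Maclaurin expansion. *)
Lemma phi_sum_lower J x M : 0 < x ->
  lambert_primitive J (INR (S M) * x) + zeta2 J - x / 2
    + x ^ 2 / 12 * (dphi (INR (S (S M)) * x) - dphi x) + x * phi (INR (S M) * x) / 2
  <= x * sum_f_R0 (fun m => phi (INR m * x)) (S M).
Proof.
  intros Hx.
  assert (G : forall m, x * ddphi (INR (S m) * x) >=
      dphi (INR (S (S m)) * x) - dphi (INR (S m) * x)).
  { intros m; rewrite (S_INR (S m)); set (y := INR (S m) * x).
    assert (0 < y) by (apply Rmult_lt_0_compat; [apply lt_0_INR; lia|auto]).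
    replace ((INR (S m) + 1) * x) with (y + x) by (unfold y; ring).
    enough (dphi (y + x) - dphi y <= ddphi y * (y + x) - ddphi y * y) by lra.
    apply (derive_le dphi (fun t => ddphi y * t) ddphi (fun _ => ddphi y)); [lra| | |].
    - intros; apply is_derive_dphi; lra.
    - intros; auto_derive; [auto|ring].
    - intros; apply ddphi_decr; lra. }
  induction M as [|M IH].
  - simpl sum_f_R0; rewrite Rmult_0_l, phi_0.
    generalize (trapezoid_first_cell J x Hx) (G 0%nat).
    rewrite lambert_primitive_0; change (INR 1) with 1; rewrite Rmult_1_l.
    set (u := dphi (INR 2 * x)); intros H1 H2.
    assert (x ^ 2 / 12 * (u - dphi x) <= x ^ 2 / 12 * (x * ddphi x)).
    { apply Rmult_le_compat_l; [nra|lra]. }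
    lra.
  - rewrite tech5, Rmult_plus_distr_l.
    assert (T := trapezoid_cell J (INR (S M) * x) (INR (S (S M)) * x)).
    assert (HM : 0 < INR (S M) * x) by (apply Rmult_lt_0_compat; [apply lt_0_INR; lia|auto]).
    assert (E : INR (S (S M)) * x - INR (S M) * x = x) by (rewrite (S_INR (S M)); ring).
    rewrite E in T; specialize (T ltac:(lra)); specialize (G (S M)).
    set (u := dphi (INR (S (S (S M))) * x)) in *.
    set (w := dphi (INR (S (S M)) * x)) in *.
    assert (x ^ 2 / 12 * (u - w) <= x ^ 2 / 12 * (x * ddphi (INR (S (S M)) * x))).
    { apply Rmult_le_compat_l; [nra|lra]. }
    lra.
Qed.

(** The truncation omits $\phi(y)e^{-(J+1)y}\le e^{-(J+1)y}$. Adding a primitive of this remainder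
    gives a function whose derivative majorizes [phi]. *)
Definition upper_primitive (J : nat) (y : R) : R :=
  lambert_primitive J y - exp (- (INR (S J) * y)) / INR (S J).

Lemma is_derive_upper_primitive J y :
  is_derive (upper_primitive J) y (lambert_partial J y + exp (- (INR (S J) * y))).
Proof.
  assert (0 < INR (S J)) by (apply lt_0_INR; lia).
  assert (D := is_derive_lambert_primitive J y).
  unfold upper_primitive; auto_derive.
  - eexists; exact D.
  - rewrite (is_derive_unique (fun x : R => lambert_primitive J x) _ _ D).
    change (match J with O => 1 | S _ => INR J + 1 end) with (INR (S J)).
    field; lra.
Qed.

Lemma phi_le_upper_derive J y : 0 < y ->
  phi y <= lambert_partial J y + exp (- (INR (S J) * y)).
Proof.
  intros Hy; rewrite lambert_partial_val by auto.
  generalize (phi_le_1 y Hy) (exp_pos (- (INR (S J) * y))); nra.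
Qed.

(** [phi] is convex, so $2\phi(c)\le\phi(c+t)+\phi(c-t)$, and each value is at most the derivative
    of [upper_primitive] there. *)
Lemma midpoint_cell J c w : 0 <= w < c ->
  2 * w * phi c <= upper_primitive J (c + w) - upper_primitive J (c - w).
Proof.
  intros Hc.
  enough (2 * w * phi c - 2 * 0 * phi c <=
    (upper_primitive J (c + w) - upper_primitive J (c - w)) -
    (upper_primitive J (c + 0) - upper_primitive J (c - 0))).
  { rewrite Rplus_0_r, Rminus_0_r in H; lra. }
  set (g := fun y => lambert_partial J y + exp (- (INR (S J) * y))).
  apply (derive_le (fun t => 2 * t * phi c)
    (fun t => upper_primitive J (c + t) - upper_primitive J (c - t))
    (fun _ => 2 * phi c) (fun t => g (c + t) + g (c - t))); [lra| | |].
  - intros; auto_derive; [auto|ring].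
  - intros t Ht.
    assert (D1 := is_derive_upper_primitive J (c + t)).
    assert (D2 := is_derive_upper_primitive J (c + - t)).
    auto_derive.
    + repeat split; eexists; eassumption.
    + rewrite (is_derive_unique (fun x : R => upper_primitive J x) _ _ D1).
      rewrite (is_derive_unique (fun x : R => upper_primitive J x) _ _ D2); unfold g, Rminus; ring.
  - intros t Ht.
    apply Rle_trans with (phi (c + t) + phi (c - t)).
    + enough (phi (c + 0) + phi (c - 0) <= phi (c + t) + phi (c - t))
        by (rewrite Rplus_0_r, Rminus_0_r in H; lra).
      apply (derive_nonneg (fun t => phi (c + t) + phi (c - t))
        (fun t => dphi (c + t) - dphi (c - t))); [lra| |].
      * intros u Hu.
        assert (D1 := is_derive_phi (c + u) ltac:(lra)).
        assert (D2 := is_derive_phi (c + - u) ltac:(lra)).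
        auto_derive.
        -- repeat split; eexists; eassumption.
        -- rewrite (is_derive_unique (fun x : R => phi x) _ _ D1).
           rewrite (is_derive_unique (fun x : R => phi x) _ _ D2); unfold Rminus; ring.
      * intros u Hu; generalize (dphi_incr (c - u) (c + u) ltac:(lra)); lra.
    + generalize (phi_le_upper_derive J (c + t) ltac:(lra)) (phi_le_upper_derive J (c - t) ltac:(lra)).
      unfold g; lra.
Qed.

(** The midpoint cells cover only $y\ge x/2$; on $[0,x/2]$ the bound $\phi(t)\ge1-t/2$ takes
    $x/2-x^2/16$ away from $\zeta(2)$. The term $1/(J+1)$ comes from [upper_primitive J 0] and
    disappears as [J] grows. *)
Lemma phi_sum_upper x M : 0 < x ->
  x * sum_f_R0 (fun m => phi (INR m * x)) M <= PI ^ 2 / 6 - x / 2 + x ^ 2 / 16.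
Proof.
  intros Hx.
  assert (B : forall J, x * sum_f_R0 (fun m => phi (INR m * x)) M <=
     PI ^ 2 / 6 + / INR (S J) - x / 2 + x ^ 2 / 16).
  { intros J.
    assert (C : x * sum_f_R0 (fun m => phi (INR m * x)) M <=
       upper_primitive J ((INR M + / 2) * x) - upper_primitive J (x / 2)).
    { induction M as [|M IH].
      - simpl sum_f_R0; change (INR 0) with 0; rewrite Rmult_0_l, phi_0.
        replace ((0 + / 2) * x) with (x / 2) by field; lra.
      - rewrite tech5, Rmult_plus_distr_l.
        assert (T := midpoint_cell J (INR (S M) * x) (x / 2)).
        assert (HM : 1 <= INR (S M)) by (apply (le_INR 1); lia).
        specialize (T ltac:(nra)).
        rewrite S_INR in *.
        replace ((INR M + 1) * x + x / 2) with ((INR M + 1 + / 2) * x) in T by field.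
        replace ((INR M + 1) * x - x / 2) with ((INR M + / 2) * x) in T by field.
        lra. }
    assert (HJ : 0 < INR (S J)) by (apply lt_0_INR; lia).
    assert (N : upper_primitive J ((INR M + / 2) * x) <= 0).
    { assert (0 <= (INR M + / 2) * x).
      { apply Rmult_le_pos; [generalize (pos_INR M)|]; lra. }
      unfold upper_primitive.
      generalize (lambert_primitive_nonpos J _ H); intros.
      assert (0 < exp (- (INR (S J) * ((INR M + / 2) * x))) / INR (S J))
        by (apply Rdiv_lt_0_compat; auto using exp_pos).
      lra. }
    assert (E : x / 2 - (x / 2) ^ 2 / 4 - (0 - 0 ^ 2 / 4) <=
      upper_primitive J (x / 2) - upper_primitive J 0).
    { apply (derive_le (fun t => t - t ^ 2 / 4) (upper_primitive J) (fun t => 1 - t / 2)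
       (fun y => lambert_partial J y + exp (- (INR (S J) * y)))); [lra| | |].
      - intros; auto_derive; [auto|field].
      - intros; apply is_derive_upper_primitive.
      - intros t Ht; destruct (Req_dec t 0) as [->|Hn].
        + rewrite Rmult_0_r, Ropp_0, exp_0; unfold lambert_partial.
          rewrite (sum_eq _ (fun _ => 0)), sum_cte; [lra|intros; ring].
        + apply Rle_trans with (phi t).
          * apply phi_ge; lra.
          * apply phi_le_upper_derive; lra. }
    unfold upper_primitive at 2 in E.
    rewrite lambert_primitive_0, Rmult_0_r, Ropp_0, exp_0 in E.
    generalize (zeta2_le J); intros.
    unfold Rdiv in E at 4; lra. }
  apply le_epsilon; intros eps He.
  destruct (nfloor_ex (/ eps)) as [n Hn]; [apply Rlt_le, Rinv_0_lt_compat; lra|].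
  specialize (B n).
  assert (/ INR (S n) <= eps).
  { rewrite <- (Rinv_inv eps); apply Rinv_le_contravar.
    - apply Rinv_0_lt_compat; lra.
    - rewrite S_INR; lra. }
  lra.
Qed.

(** * Truncated generating functions of the weights at $q=e^{-x}$ *)

Definition poly (a : nat -> R) (K : nat) (q : R) : R :=
  sum_f_R0 (fun k => a k * q ^ k) K.

Lemma pow_unit q k : 0 < q <= 1 -> 0 < q ^ k <= 1.
Proof.
  intros Hq; split; [apply pow_lt; lra|]; rewrite <- (pow1 k); apply pow_incr; lra.
Qed.

Lemma pow_antitone q m n : 0 < q <= 1 -> (m <= n)%nat -> q ^ n <= q ^ m.
Proof.
  intros Hq H; replace n with (m + (n - m))%nat by lia; rewrite pow_add.
  generalize (pow_unit q m Hq) (pow_unit q (n - m) Hq); nra.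
Qed.

Lemma poly_add a b K q : poly (seq_add a b) K q = poly a K q + poly b K q.
Proof. unfold poly, seq_add; rewrite <- sum_plus; apply sum_eq; intros; ring. Qed.

Lemma poly_scale r a K q : poly (scale r a) K q = r * poly a K q.
Proof. unfold poly, scale; rewrite scal_sum; apply sum_eq; intros; ring. Qed.

Lemma poly_unit K q : poly unit_seq K q = 1.
Proof.
  unfold poly; induction K as [|K IH]; [simpl; ring|].
  rewrite tech5, IH; simpl; ring.
Qed.

Lemma poly_mono a K K' q : nonneg a -> 0 <= q -> (K <= K')%nat ->
  poly a K q <= poly a K' q.
Proof.
  intros Ha Hq; induction 1 as [|K' HK IH]; [lra|].
  unfold poly in *; rewrite tech5.
  assert (0 <= a (S K') * q ^ S K') by (apply Rmult_le_pos; [apply Ha|apply pow_le; auto]).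
  lra.
Qed.

Lemma poly_shift m a K q :
  poly (shift m a) K q = if (m <=? K)%nat then q ^ m * poly a (K - m) q else 0.
Proof.
  revert K; induction m as [|m IH]; intros K.
  - rewrite Nat.sub_0_r; simpl; ring.
  - change (shift (S m) a) with (shift1 (shift m a)).
    destruct K as [|K]; [unfold poly; simpl; ring|].
    unfold poly; rewrite decomp_sum by lia; simpl shift1.
    change (pred (S K)) with K; change (S m <=? S K)%nat with (m <=? K)%nat.
    change (S K - S m)%nat with (K - m)%nat.
    rewrite (sum_eq _ (fun k => shift m a k * q ^ k * q)) by (intros; simpl; ring).
    rewrite <- scal_sum; fold (poly (shift m a) K q) (poly a (K - m) q); rewrite IH.
    destruct (m <=? K)%nat; simpl; ring.
Qed.

Lemma poly_log_weight m K q : (0 < m)%nat ->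
  poly (log_weight m) K q =
  if (m <=? K)%nat then q ^ m * (INR m + poly (log_weight m) (K - m) q) else 0.
Proof.
  intros Hm; rewrite (log_weight_fix m Hm) at 1; rewrite poly_shift, poly_add, poly_scale, poly_unit.
  rewrite Rmult_1_r; reflexivity.
Qed.

Lemma log_weight_nonneg m : nonneg (log_weight m).
Proof.
  intros [|k]; unfold log_weight; [lra|].
  apply Rmult_le_pos; [apply pos_INR|]; unfold multiples; destruct (_ =? _)%nat; lra.
Qed.

Lemma poly_log_weight_0 K q : poly (log_weight 0) K q = 0.
Proof.
  unfold poly; rewrite (sum_eq _ (fun _ => 0)), sum_cte; [ring|].
  intros [|i] _; simpl; ring.
Qed.

Lemma exp_neg_pow x k : exp (- x) ^ k = exp (- (INR k * x)).
Proof.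
  induction k as [|k IH]; [simpl; rewrite Rmult_0_l, Ropp_0, exp_0; reflexivity|].
  rewrite S_INR; simpl; rewrite IH, <- exp_plus; f_equal; ring.
Qed.

Lemma phi_mult m x : 0 < x -> phi (INR m * x) / x = INR m / (exp (INR m * x) - 1).
Proof.
  intros; unfold phi, Rdiv; generalize (/ (exp (INR m * x) - 1)); intros; field; lra.
Qed.

Lemma poly_log_weight_le m K x : 0 < x ->
  poly (log_weight m) K (exp (- x)) <= phi (INR m * x) / x.
Proof.
  intros Hx; destruct m as [|m].
  { rewrite poly_log_weight_0; change (INR 0) with 0; rewrite Rmult_0_l, phi_0; lra. }
  assert (Hr : 0 < INR (S m)) by (apply lt_0_INR; lia).
  assert (HE : 0 < exp (INR (S m) * x) - 1) by (apply exp_gt_1; nra).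
  rewrite phi_mult by auto.
  induction K as [K IH] using lt_wf_ind.
  rewrite poly_log_weight by lia.
  assert (0 < INR (S m) / (exp (INR (S m) * x) - 1)) by (apply Rdiv_lt_0_compat; lra).
  destruct (Nat.leb_spec (S m) K) as [H1|H1]; [|lra].
  specialize (IH (K - S m)%nat ltac:(lia)).
  rewrite exp_neg_pow, exp_Ropp.
  set (E := exp (INR (S m) * x)) in *; set (r := INR (S m)) in *.
  apply Rmult_le_reg_l with E; [lra|].
  rewrite <- Rmult_assoc, Rinv_r, Rmult_1_l by lra.
  replace (E * (r / (E - 1))) with (r + r / (E - 1)) by (field; lra); lra.
Qed.

Lemma poly_log_weight_eq m J x : 0 < x ->
  poly (log_weight m) (m * J) (exp (- x)) =
  phi (INR m * x) / x * (1 - exp (- x) ^ (m * J)).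
Proof.
  intros Hx; destruct m as [|m].
  { rewrite poly_log_weight_0; change (INR 0) with 0; rewrite Rmult_0_l, phi_0; lra. }
  assert (Hr : 0 < INR (S m)) by (apply lt_0_INR; lia).
  assert (HE : 0 < exp (INR (S m) * x) - 1) by (apply exp_gt_1; nra).
  rewrite phi_mult by auto.
  induction J as [|J IH].
  - rewrite Nat.mul_0_r, poly_log_weight by lia; simpl; ring.
  - rewrite poly_log_weight by lia.
    destruct (Nat.leb_spec (S m) (S m * S J)) as [H1|H1]; [|lia].
    replace (S m * S J - S m)%nat with (S m * J)%nat by lia; rewrite IH.
    replace (S m * S J)%nat with (S m + S m * J)%nat by lia.
    rewrite pow_add, (exp_neg_pow x (S m)), exp_Ropp.
    field; lra.
Qed.

Definition minorant_weight (k : nat) : R := 24 * sigma1 k + 12 * log_weight 1 k.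

Lemma poly_sigma1 K q :
  poly sigma1 K q = sum_f_R0 (fun m => poly (log_weight m) K q) K.
Proof.
  unfold poly at 1.
  rewrite (sum_eq _ (fun k => sum_f_R0 (fun m => log_weight m k * q ^ k) K)).
  2: { intros k Hk; rewrite <- (sigma1_stable K k Hk), Rmult_comm, scal_sum; reflexivity. }
  assert (sum_swap : forall (f : nat -> nat -> R) A B,
    sum_f_R0 (fun k => sum_f_R0 (fun m => f m k) A) B =
    sum_f_R0 (fun m => sum_f_R0 (fun k => f m k) B) A).
  { intros f A B; induction B as [|B IH]; [reflexivity|].
    rewrite tech5, IH, <- sum_plus; apply sum_eq; intros; rewrite tech5; reflexivity. }
  apply sum_swap.
Qed.

Lemma poly_minorant K q :
  poly minorant_weight K q =
  24 * sum_f_R0 (fun m => poly (log_weight m) K q) K + 12 * poly (log_weight 1) K q.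
Proof.
  rewrite <- poly_sigma1, <- !poly_scale, <- poly_add; reflexivity.
Qed.

(** The terms in $1/x$ cancel, and the constants are arranged to cancel too:
    $24\cdot\frac1{16}=12\cdot\frac18$. The true constant $-5$ is given up, as this bound is only
    used with the small factor [a]. *)
Lemma poly_minorant_le K x : 0 < x <= 6 ->
  poly minorant_weight K (exp (- x)) <= 4 * PI ^ 2 / x ^ 2.
Proof.
  intros [Hx Hx6]; rewrite poly_minorant.
  assert (H1 := poly_log_weight_le 1 K x Hx).
  assert (H2 : sum_f_R0 (fun m => poly (log_weight m) K (exp (- x))) K <=
    sum_f_R0 (fun m => phi (INR m * x)) K * / x).
  { rewrite Rmult_comm, scal_sum; apply sum_Rle; intros; apply poly_log_weight_le; auto. }
  assert (H3 := phi_sum_upper x K Hx).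
  set (s := sum_f_R0 (fun m => phi (INR m * x)) K) in *.
  assert (H4 : s * / x <= (PI ^ 2 / 6 - x / 2 + x ^ 2 / 16) * / x ^ 2).
  { replace (s * / x) with (x * s * / x ^ 2) by (field; lra).
    apply Rmult_le_compat_r; auto.
    apply Rlt_le, Rinv_0_lt_compat, pow_lt; auto. }
  assert (H5 : phi (INR 1 * x) / x <= / (x * (1 + x / 2))).
  { rewrite phi_mult by auto; change (INR 1) with 1; rewrite Rmult_1_l.
    unfold Rdiv; rewrite Rmult_1_l; apply Rinv_le_contravar; [nra|].
    generalize (exp_ge_quad x (Rlt_le _ _ Hx)); lra. }
  (* After clearing denominators this is $x^2/16\le3x/8$, which is where $x\le6$ comes from. *)
  assert (H6 : / (x * (1 + x / 2)) <= / x - / 8).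
  { apply Rmult_le_reg_r with (x * (1 + x / 2)); [nra|].
    rewrite Rinv_l by nra.
    replace ((/ x - / 8) * (x * (1 + x / 2))) with (1 + x / 2 - x / 8 * (1 + x / 2))
      by (field; lra).
    nra. }
  replace (4 * PI ^ 2 / x ^ 2) with
    (24 * ((PI ^ 2 / 6 - x / 2 + x ^ 2 / 16) * / x ^ 2) + 12 * (/ x - / 8)) by (field; lra).
  lra.
Qed.

(** The coefficient 1/5 in place of 1/6 absorbs the tail: $e^{-x}$ times the cubic has derivative
    $e^{-x}x^2(1/10-x/5)$, nonnegative up to $x=1/2$. *)
Lemma exp_le_cubic x : 0 <= x <= / 2 -> exp x <= 1 + x + x ^ 2 / 2 + x ^ 3 / 5.
Proof.
  intros Hx.
  assert (H : exp (- 0) * (1 + 0 + 0 ^ 2 / 2 + 0 ^ 3 / 5)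
     <= exp (- x) * (1 + x + x ^ 2 / 2 + x ^ 3 / 5)).
  { apply (derive_nonneg (fun x => exp (- x) * (1 + x + x ^ 2 / 2 + x ^ 3 / 5))
      (fun x => exp (- x) * (x ^ 2 * (/ 10 - x / 5)))); [lra| |].
    - intros t _; auto_derive; [auto|].
      generalize (exp (- t)); intros; field.
    - intros t Ht; apply Rmult_le_pos; [apply Rlt_le, exp_pos|].
      apply Rmult_le_pos; [nra|lra]. }
  rewrite Ropp_0, exp_0, exp_Ropp in H.
  apply Rmult_le_reg_l with (/ exp x); [apply Rinv_0_lt_compat, exp_pos|].
  rewrite Rinv_l by (generalize (exp_pos x); lra); lra.
Qed.

Lemma dphi_le x : 0 < x <= / 2 -> dphi x <= - (/ 2 - x / 4).
Proof.
  intros Hx; unfold dphi.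
  assert (HE := exp_gt_1 x ltac:(lra)); assert (HU := exp_le_cubic x ltac:(lra)).
  set (D := exp x - 1) in *.
  replace (exp x) with (D + 1) by (unfold D; ring).
  assert (HD : D <= x + x ^ 2 / 2 + x ^ 3 / 5) by (unfold D; lra).
  clearbody D.
  apply Rmult_le_reg_r with (D ^ 2); [apply pow_lt; auto|].
  replace ((D - x * (D + 1)) / D ^ 2 * D ^ 2) with (D - x * (D + 1)) by (field; lra).
  set (U := x + x ^ 2 / 2 + x ^ 3 / 5) in *.
  assert (D ^ 2 <= U ^ 2) by (apply pow_incr; lra).
  assert ((/ 2 - x / 4) * D ^ 2 <= (/ 2 - x / 4) * U ^ 2) by (apply Rmult_le_compat_l; lra).
  assert (D * (1 - x) <= U * (1 - x)) by (apply Rmult_le_compat_r; lra).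
  enough (U * (1 - x) - x + (/ 2 - x / 4) * U ^ 2 <= 0) by lra.
  replace (U * (1 - x) - x + (/ 2 - x / 4) * U ^ 2) with
    (- (x ^ 3 * (/ 20 + x / 8 + x ^ 2 / 16 + 3 * x ^ 3 / 100 + x ^ 4 / 100)))
    by (unfold U; field).
  assert (0 < x ^ 2 /\ 0 < x ^ 3 /\ 0 < x ^ 4) by (repeat split; apply pow_lt; lra).
  assert (0 <= x ^ 3 * (/ 20 + x / 8 + x ^ 2 / 16 + 3 * x ^ 3 / 100 + x ^ 4 / 100))
    by (apply Rmult_le_pos; lra).
  lra.
Qed.

Lemma phi_over_x_ge x : 0 < x <= / 2 -> / x - / 2 + x / 24 <= phi x / x.
Proof.
  intros Hx.
  assert (HE := exp_gt_1 x ltac:(lra)); assert (HU := exp_le_cubic x ltac:(lra)).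
  unfold phi; replace (x / (exp x - 1) / x) with (/ (exp x - 1)) by (field; lra).
  apply Rmult_le_reg_r with (x * (exp x - 1)); [nra|].
  replace (/ (exp x - 1) * (x * (exp x - 1))) with x by (field; lra).
  replace ((/ x - / 2 + x / 24) * (x * (exp x - 1))) with
    ((1 - x / 2 + x ^ 2 / 24) * (exp x - 1)) by (field; lra).
  apply Rle_trans with ((1 - x / 2 + x ^ 2 / 24) * (x + x ^ 2 / 2 + x ^ 3 / 5)).
  - apply Rmult_le_compat_l; [nra|lra].
  - replace ((1 - x / 2 + x ^ 2 / 24) * (x + x ^ 2 / 2 + x ^ 3 / 5)) with
      (x - x ^ 3 * (/ 120 + 19 * x / 240 - x ^ 2 / 120)) by field.
    assert (0 < x ^ 3) by (apply pow_lt; lra).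
    assert (0 <= x ^ 3 * (/ 120 + 19 * x / 240 - x ^ 2 / 120)) by (apply Rmult_le_pos; nra).
    lra.
Qed.

Lemma phi_sum_lower_limit x d : 0 < x <= / 2 -> 0 < d -> exists M,
  PI ^ 2 / 6 - x / 2 + x ^ 2 / 24 - x ^ 3 / 48 - d <=
  x * sum_f_R0 (fun m => phi (INR m * x)) (S M).
Proof.
  intros Hx Hd.
  destruct (zeta2_ge (d / 2)) as [J HJ]; [lra|].
  (* With [J] fixed, the terms at the far endpoint $Y$ amount to at most $B/Y$: $2(J+1)/Y$ from
     [lambert_primitive_ge] and $1/Y$ from [dphi_ge]. *)
  set (B := 2 * INR (S J) + 1).
  assert (HB : 0 < B) by (unfold B; generalize (pos_INR (S J)); lra).
  destruct (nfloor_ex (2 * B / (d * x))) as [M HM].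
  { apply Rlt_le, Rdiv_lt_0_compat; nra. }
  exists M; apply Rle_trans with (2 := phi_sum_lower J x M (proj1 Hx)).
  rewrite <- S_INR in HM; set (Y := INR (S M) * x).
  assert (HM0 : 0 < INR (S M)) by (apply lt_0_INR; lia).
  assert (HY : 0 < Y) by (apply Rmult_lt_0_compat; lra).
  assert (HBY : B / Y <= d / 2).
  { apply Rmult_le_reg_r with (2 * Y / d); [apply Rdiv_lt_0_compat; lra|].
    replace (B / Y * (2 * Y / d)) with (2 * B / (d * x) * x) by (field; lra).
    replace (d / 2 * (2 * Y / d)) with Y by (field; lra).
    apply Rmult_le_compat_r; lra. }
  assert (H1 := lambert_primitive_ge J Y HY).
  assert (H2 := phi_pos Y HY).
  assert (H3 := dphi_le x Hx).
  assert (H4 : - (3 / Y) <= dphi (INR (S (S M)) * x)).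
  { assert (Y <= INR (S (S M)) * x) by (rewrite (S_INR (S M)); unfold Y; nra).
    apply Rle_trans with (dphi Y); [apply dphi_ge; auto|apply dphi_incr; lra]. }
  set (u := dphi (INR (S (S M)) * x)) in *.
  assert (H5 : x ^ 2 / 12 * (- (3 / Y) + (/ 2 - x / 4)) <= x ^ 2 / 12 * (u - dphi x)).
  { apply Rmult_le_compat_l; nra. }
  assert (H6 : x ^ 2 / 12 * (3 / Y) <= / Y).
  { replace (x ^ 2 / 12 * (3 / Y)) with (x ^ 2 / 4 * / Y) by (field; lra).
    rewrite <- (Rmult_1_l (/ Y)) at 2.
    apply Rmult_le_compat_r; [apply Rlt_le, Rinv_0_lt_compat; auto|nra]. }
  assert (H7 : 0 <= x * phi Y / 2) by nra.
  replace (B / Y) with (2 * INR (S J) / Y + / Y) in HBY by (unfold B; field; lra).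
  lra.
Qed.

Lemma sigma1_nonneg : nonneg sigma1.
Proof. intros k; apply cond_pos_sum; intros; apply log_weight_nonneg. Qed.

Lemma minorant_weight_nonneg : nonneg minorant_weight.
Proof.
  intros k; unfold minorant_weight.
  generalize (sigma1_nonneg k) (log_weight_nonneg 1 k); lra.
Qed.

Lemma sum_f_R0_mono f n n' : (forall k, 0 <= f k) -> (n <= n')%nat ->
  sum_f_R0 f n <= sum_f_R0 f n'.
Proof.
  intros Hf; induction 1 as [|n' Hn IH]; [lra|].
  rewrite tech5; specialize (Hf (S n')); lra.
Qed.

(** The terms in $1/x$ cancel, the linear terms $-24x/48$ and $12x/24$ cancel, and the constants
    give $24/24-12/2=-5$. [K0] may depend on [x], because each step of the induction uses a single
    [x]. *)
Lemma poly_minorant_ge x d : 0 < x <= / 2 -> 0 < d -> exists K0, forall K, (K0 <= K)%nat ->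
  4 * PI ^ 2 / x ^ 2 - 5 - d <= poly minorant_weight K (exp (- x)).
Proof.
  intros Hx Hd.
  destruct (phi_sum_lower_limit x (d / 2 * x ^ 2 / 24) Hx) as [M HM].
  { assert (0 < x ^ 2) by (apply pow_lt; lra); nra. }
  set (s := sum_f_R0 (fun m => phi (INR m * x)) (S M)) in *.
  set (q := exp (- x)).
  assert (Hq : 0 < q < 1).
  { split; [apply exp_pos|]; unfold q; rewrite <- exp_0; apply exp_increasing; lra. }
  set (T := 24 * (s / x) + 12 * (phi x / x)).
  assert (HT : 4 * PI ^ 2 / x ^ 2 - 5 - d / 2 <= T).
  { assert (H1 := phi_over_x_ge x Hx).
    assert (H2 : (PI ^ 2 / 6 - x / 2 + x ^ 2 / 24 - x ^ 3 / 48 - d / 2 * x ^ 2 / 24) * / x ^ 2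
       <= s / x).
    { replace (s / x) with (x * s * / x ^ 2) by (field; lra).
      apply Rmult_le_compat_r; auto.
      apply Rlt_le, Rinv_0_lt_compat, pow_lt; lra. }
    unfold T.
    replace (4 * PI ^ 2 / x ^ 2 - 5 - d / 2) with
     (24 * ((PI ^ 2 / 6 - x / 2 + x ^ 2 / 24 - x ^ 3 / 48 - d / 2 * x ^ 2 / 24) * / x ^ 2)
      + 12 * (/ x - / 2 + x / 24)) by (field; lra).
    lra. }
  assert (Hs : 0 <= s).
  { apply cond_pos_sum; intros [|m].
    - change (INR 0) with 0; rewrite Rmult_0_l, phi_0; lra.
    - apply Rlt_le, phi_pos, Rmult_lt_0_compat; [apply lt_0_INR; lia|lra]. }
  assert (HT0 : 0 <= T).
  { assert (0 <= s / x) by (apply Rmult_le_pos; [auto|apply Rlt_le, Rinv_0_lt_compat; lra]).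
    assert (0 < phi x / x) by (apply Rdiv_lt_0_compat; [apply phi_pos|]; lra).
    unfold T; lra. }
  (* Keeping the $m$-th series up to degree $m(J+1)$ loses at most the fraction $q^J$ of it, for
     every $m$ at once; the total loss $Tq^J$ is made smaller than $d/2$. *)
  destruct (pow_lt_1_zero q ltac:(rewrite Rabs_pos_eq; lra) (d / 2 / (T + 1))) as [J HJ].
  { apply Rdiv_lt_0_compat; lra. }
  specialize (HJ J (le_n J)); rewrite Rabs_pos_eq in HJ by (apply pow_le; lra).
  exists (S M * S J)%nat; intros K HK.
  assert (HqJ : forall m, (0 < m)%nat -> q ^ (m * S J) <= q ^ J)
    by (intros; apply pow_antitone; [lra|nia]).
  assert (HW : forall m, (m <= S M)%nat ->
     phi (INR m * x) * / x * (1 - q ^ J) <= poly (log_weight m) K q).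
  { intros m Hm; apply Rle_trans with (poly (log_weight m) (m * S J) q).
    - unfold q at 2; rewrite poly_log_weight_eq by lra; fold q.
      destruct m as [|m].
      + change (INR 0) with 0; rewrite Rmult_0_l, phi_0; lra.
      + apply Rmult_le_compat_l; [|specialize (HqJ (S m) ltac:(lia)); lra].
        apply Rlt_le, Rdiv_lt_0_compat; [apply phi_pos, Rmult_lt_0_compat|]; try lra.
        apply lt_0_INR; lia.
    - apply poly_mono; [apply log_weight_nonneg|lra|nia]. }
  rewrite poly_minorant.
  assert (H1 : s / x * (1 - q ^ J) <= sum_f_R0 (fun m => poly (log_weight m) K q) K).
  { apply Rle_trans with (sum_f_R0 (fun m => poly (log_weight m) K q) (S M)).
    - unfold s, Rdiv; rewrite Rmult_assoc, Rmult_comm, scal_sum.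
      apply sum_Rle; intros m Hm; rewrite <- Rmult_assoc; auto.
    - apply sum_f_R0_mono; [|nia].
      intros m; apply cond_pos_sum; intros.
      apply Rmult_le_pos; [apply log_weight_nonneg|apply pow_le; lra]. }
  assert (H2 : phi x / x * (1 - q ^ J) <= poly (log_weight 1) K q).
  { specialize (HW 1%nat ltac:(lia)); change (INR 1) with 1 in HW.
    rewrite Rmult_1_l in HW; exact HW. }
  assert (H3 : T * q ^ J <= d / 2).
  { apply Rle_trans with (T * (d / 2 / (T + 1))).
    - apply Rmult_le_compat_l; lra.
    - apply Rmult_le_reg_r with (T + 1); [lra|].
      replace (T * (d / 2 / (T + 1)) * (T + 1)) with (T * (d / 2)) by (field; lra); nra. }
  assert (T * (1 - q ^ J) <=
    24 * sum_f_R0 (fun m => poly (log_weight m) K q) K + 12 * poly (log_weight 1) K q)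
    by (unfold T; lra).
  lra.
Qed.

(** * Propagation of the lower bound *)

Lemma PI_gt_3 : 3 < PI.
Proof. generalize PI2_3_2; unfold PI2; lra. Qed.

(** The quartic term is kept because for large $k$ it has to absorb the relative error $3kw^2$ in
    [growth_ratio]. *)
Lemma cosh_quartic z : 0 <= z -> z ^ 2 + z ^ 4 / 12 <= exp z + exp (- z) - 2.
Proof.
  assert (H4 : forall z, 0 <= z -> 0 <= exp z + exp (- z) - 2).
  { intros t Ht; rewrite exp_Ropp.
    assert (He := exp_pos t).
    replace (exp t + / exp t - 2) with ((exp t - 1) ^ 2 * / exp t) by (field; lra).
    apply Rmult_le_pos; [apply pow2_ge_0|apply Rlt_le, Rinv_0_lt_compat; auto]. }
  assert (H3 : forall z, 0 <= z -> 0 <= exp z - exp (- z) - 2 * z).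
  { intros t Ht; replace 0 with (exp 0 - exp (- 0) - 2 * 0) by (rewrite Ropp_0; ring).
    apply (derive_nonneg (fun z => exp z - exp (- z) - 2 * z)
      (fun z => exp z + exp (- z) - 2)); auto.
    - intros u _; auto_derive; [auto|ring].
    - intros; apply H4; lra. }
  assert (H2 : forall z, 0 <= z -> 0 <= exp z + exp (- z) - 2 - z ^ 2).
  { intros t Ht; replace 0 with (exp 0 + exp (- 0) - 2 - 0 ^ 2)
      by (rewrite Ropp_0, exp_0; ring).
    apply (derive_nonneg (fun z => exp z + exp (- z) - 2 - z ^ 2)
      (fun z => exp z - exp (- z) - 2 * z)); auto.
    - intros u _; auto_derive; [auto|ring].
    - intros; apply H3; lra. }
  assert (H1 : forall z, 0 <= z -> 0 <= exp z - exp (- z) - 2 * z - z ^ 3 / 3).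
  { intros t Ht; replace 0 with (exp 0 - exp (- 0) - 2 * 0 - 0 ^ 3 / 3)
      by (rewrite Ropp_0; field).
    apply (derive_nonneg (fun z => exp z - exp (- z) - 2 * z - z ^ 3 / 3)
      (fun z => exp z + exp (- z) - 2 - z ^ 2)); auto.
    - intros u _; auto_derive; [auto|field].
    - intros; apply H2; lra. }
  intros Hz.
  enough (0 <= exp z + exp (- z) - 2 - z ^ 2 - z ^ 4 / 12) by lra.
  replace 0 with (exp 0 + exp (- 0) - 2 - 0 ^ 2 - 0 ^ 4 / 12)
    by (rewrite Ropp_0, exp_0; field).
  apply (derive_nonneg (fun z => exp z + exp (- z) - 2 - z ^ 2 - z ^ 4 / 12)
    (fun z => exp z - exp (- z) - 2 * z - z ^ 3 / 3)); auto.
  - intros u _; auto_derive; [auto|field].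
  - intros; apply H1; lra.
Qed.

(** The left side is $1-ts$, with square $1-t-t^2(\frac14+\frac{3t}4-s^2)$. Enlarging the Taylor
    coefficient $1/16$ of $t^3$ to $3/8$ makes the bound valid up to $t=1$, where both sides
    vanish. *)
Lemma sqrt_one_minus t : 0 <= t <= 1 ->
  1 - t / 2 - t ^ 2 / 8 - 3 * t ^ 3 / 8 <= sqrt (1 - t).
Proof.
  intros Ht; set (r := 1 - t / 2 - t ^ 2 / 8 - 3 * t ^ 3 / 8).
  destruct (Rle_dec r 0) as [H|H].
  { apply Rle_trans with (1 := H), sqrt_pos. }
  rewrite <- (sqrt_pow2 r) by lra.
  apply sqrt_le_1_alt.
  set (s := / 2 + t / 8 + 3 * t ^ 2 / 8).
  assert (Hs : s ^ 2 <= / 4 + 3 * t / 4).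
  { apply Rle_trans with (((1 + t) / 2) ^ 2); [|nra].
    apply pow_incr; unfold s; nra. }
  replace (r ^ 2) with (1 - t - t ^ 2 * (/ 4 + 3 * t / 4 - s ^ 2)) by (unfold r, s; field).
  assert (0 <= t ^ 2 * (/ 4 + 3 * t / 4 - s ^ 2)) by (apply Rmult_le_pos; nra).
  lra.
Qed.

Definition growth (m : R) : R := exp (4 * PI * sqrt m) / m.

Lemma growth_pos m : 0 < m -> 0 < growth m.
Proof. intros; apply Rdiv_lt_0_compat; auto using exp_pos. Qed.

(* [w] stands for [1 / sqrt n]. *)
Lemma growth_ratio n w k : 0 < w -> n = / w ^ 2 -> 0 <= k < n ->
  growth n * exp (- (k * (2 * PI * w - w ^ 2)))
    * (1 - PI / 2 * w ^ 3 * k ^ 2 * (1 + 3 * k * w ^ 2)) <= growth (n - k).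
Proof.
  intros Hw Hn Hk; assert (HP := PI_RGT_0).
  (* This is $4\pi\sqrt n\,(t^2/8+3t^3/8)$ with $t=k/n$: the part of the exponent beyond its linear
     term. *)
  set (u := PI / 2 * w ^ 3 * k ^ 2 * (1 + 3 * k * w ^ 2)).
  set (x := 2 * PI * w - w ^ 2).
  assert (Hw2 : 0 < w ^ 2) by (apply pow_lt; auto).
  assert (Hn0 : 0 < n) by (rewrite Hn; apply Rinv_0_lt_compat; auto).
  assert (Hsn : sqrt n = / w).
  { rewrite Hn; replace (/ w ^ 2) with ((/ w) ^ 2) by (field; lra).
    apply sqrt_pow2, Rlt_le, Rinv_0_lt_compat; auto. }
  assert (Hnw : n * w ^ 2 = 1) by (rewrite Hn; field; lra).
  assert (Ht : 0 <= k * w ^ 2 < 1) by nra.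
  assert (Hs : 4 * PI * sqrt n - 2 * PI * w * k - u <= 4 * PI * sqrt (n - k)).
  { replace (n - k) with (n * (1 - k * w ^ 2)) by (rewrite Hn; field; lra).
    rewrite sqrt_mult by lra; rewrite Hsn.
    apply Rle_trans with (4 * PI * (/ w * (1 - (k * w ^ 2) / 2 - (k * w ^ 2) ^ 2 / 8
      - 3 * (k * w ^ 2) ^ 3 / 8))).
    - apply Req_le; unfold u; field; lra.
    - apply Rmult_le_compat_l; [lra|]; apply Rmult_le_compat_l.
      + apply Rlt_le, Rinv_0_lt_compat; auto.
      + apply sqrt_one_minus; lra. }
  (* From $1-t\le e^{-t}$ with $t=k/n$. The denominator of [growth] thus accounts for the $-w^2$ in
     [x], the gain that later pays for [u]. *)
  assert (Hi : exp (k * w ^ 2) / n <= / (n - k)).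
  { apply Rmult_le_reg_r with (n * exp (- (k * w ^ 2))); [apply Rmult_lt_0_compat; auto using exp_pos|].
    replace (exp (k * w ^ 2) / n * (n * exp (- (k * w ^ 2)))) with 1
      by (rewrite exp_Ropp; field; split; [generalize (exp_pos (k * w ^ 2))|]; lra).
    apply Rmult_le_reg_l with (n - k); [lra|].
    rewrite <- Rmult_assoc, Rinv_r, Rmult_1_l, Rmult_1_r by lra.
    apply Rle_trans with (n * (1 + - (k * w ^ 2))); [nra|].
    apply Rmult_le_compat_l; [lra|]; apply exp_ineq1_le. }
  change (growth (n - k)) with (exp (4 * PI * sqrt (n - k)) * / (n - k)); unfold growth.
  apply Rle_trans with (exp (4 * PI * sqrt n - 2 * PI * w * k - u) * (exp (k * w ^ 2) / n)).
  - replace (exp (4 * PI * sqrt n - 2 * PI * w * k - u)) with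
      (exp (4 * PI * sqrt n) * exp (- (k * x)) * exp (- u) * exp (- (k * w ^ 2))).
    2: { rewrite <- !exp_plus; f_equal; unfold x; ring. }
    rewrite (exp_Ropp (k * w ^ 2)).
    replace (exp (4 * PI * sqrt n) * exp (- (k * x)) * exp (- u) * / exp (k * w ^ 2) *
      (exp (k * w ^ 2) / n)) with (exp (4 * PI * sqrt n) / n * exp (- (k * x)) * exp (- u))
      by (field; split; [lra|generalize (exp_pos (k * w ^ 2)); lra]).
    apply Rmult_le_compat_l.
    + apply Rmult_le_pos; [apply Rlt_le, Rdiv_lt_0_compat; auto|apply Rlt_le]; apply exp_pos.
    + generalize (exp_ineq1_le (- u)); lra.
  - apply Rmult_le_compat; auto.
    + apply Rlt_le, exp_pos.
    + apply Rlt_le, Rdiv_lt_0_compat; auto using exp_pos.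
    + destruct Hs as [Hs|Hs]; [apply Rlt_le, exp_increasing; auto|rewrite Hs; lra].
Qed.

(** Multiply by $w^2$ and put $e=w/(2\pi)$, $l=(1-e)^{-2}$, $c=1+13w^2$. The $-w^2$ in [x] gains
    $l-1\approx2e$; the hyperbolic cosine costs
    $a(\frac{16}9+\frac{16}{25}-2)l=\frac{376}{225}ecl^2\approx1.67e$, and what remains is small. As
    $v/x\to0$ the cost would tend to $1.5e$, while an exponent $\beta$ of $n$ in the bound would
    gain $2\beta e$: this is the threshold $\beta=3/4$. The choice $v=x/4$ spends part of the
    margin. *)
Lemma saddle_inequality w : 0 < w <= / 17 ->
  let x := 2 * PI * w - w ^ 2 in
  let a := PI / 2 * w ^ 3 * (1 + 13 * w ^ 2) / (x / 4) ^ 2 in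
  / w ^ 2 - 5 <=
  (1 + 2 * a) * (4 * PI ^ 2 / x ^ 2 - 5 - / 100)
    - a * (4 * PI ^ 2 / (x - x / 4) ^ 2) - a * (4 * PI ^ 2 / (x + x / 4) ^ 2).
Proof.
  intros Hw x a; assert (HP := PI_gt_3); assert (HP4 := PI_4).
  set (e := w / (2 * PI)).
  assert (He : 0 < e <= / 102).
  { unfold e; split; [apply Rdiv_lt_0_compat; lra|].
    apply Rmult_le_reg_r with (2 * PI); [lra|].
    replace (w / (2 * PI) * (2 * PI)) with w by (field; lra); lra. }
  set (l := / (1 - e) ^ 2).
  assert (Hl : 0 < l <= 1.02).
  { unfold l; split; [apply Rinv_0_lt_compat; nra|].
    rewrite <- (Rinv_inv 1.02); apply Rinv_le_contravar; [lra|nra]. }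
  assert (Hx : x = 2 * PI * w * (1 - e)) by (unfold x, e; field; lra).
  assert (Hx0 : 0 < x) by (unfold x; nra).
  assert (HL : 4 * PI ^ 2 / x ^ 2 = l / w ^ 2) by (rewrite Hx; unfold l; field; lra).
  set (c := 1 + 13 * w ^ 2) in *.
  assert (Hc : 1 <= c <= 1.045) by (unfold c; nra).
  assert (Ha : a = 4 * e * c * l).
  { unfold a, l; rewrite Hx; unfold e; field; repeat split; lra. }
  replace (4 * PI ^ 2 / (x - x / 4) ^ 2) with (16 / 9 * (4 * PI ^ 2 / x ^ 2))
    by (field; repeat split; lra).
  replace (4 * PI ^ 2 / (x + x / 4) ^ 2) with (16 / 25 * (4 * PI ^ 2 / x ^ 2))
    by (field; repeat split; lra).
  rewrite HL, Ha.
  apply Rmult_le_reg_r with (w ^ 2); [apply pow_lt; lra|].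
  replace ((/ w ^ 2 - 5) * w ^ 2) with (1 - 5 * w ^ 2) by (field; lra).
  match goal with |- _ <= ?r => replace r with
    (l - 376 / 225 * e * c * l ^ 2 - (1 + 8 * e * c * l) * (5 + / 100) * w ^ 2)
    by (field; lra) end.
  assert (Hl1 : l - 1 = e * (2 - e) * l) by (unfold l; field; lra).
  assert (Hwe : w ^ 2 <= 8 * w * e).
  { unfold e; replace (8 * w * (w / (2 * PI))) with (4 / PI * w ^ 2) by (field; lra).
    assert (1 <= 4 / PI).
    { apply Rmult_le_reg_r with PI; [lra|].
      replace (4 / PI * PI) with 4 by (field; lra); lra. }
    nra. }
  assert (H1 : / 100 * w ^ 2 <= e * l * (/ 100)).
  { assert (w * 8 <= 8 / 17) by lra.
    assert (1 <= l) by (apply Rmult_le_reg_r with ((1 - e) ^ 2); [nra|]; unfold l; rewrite Rinv_l; nra).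
    nra. }
  assert (H2 : 376 / 225 * (c * l) <= 376 / 225 * (1.045 * 1.02)).
  { apply Rmult_le_compat_l; [lra|]; apply Rmult_le_compat; lra. }
  assert (H3 : 8 * c * (5 + / 100) * w ^ 2 <= 8 * 1.045 * (5 + / 100) * / 289).
  { apply Rmult_le_compat; nra. }
  assert (H4 : 0 <= e * l * (2 - e - 376 / 225 * (c * l) - / 100
     - 8 * c * (5 + / 100) * w ^ 2)).
  { apply Rmult_le_pos; [nra|lra]. }
  lra.
Qed.

(* Minorizes the ratio of the growth function at [n - k] and [n]; being a combination of
   exponentials, it has weighted sums that are values of the Lambert series, and being
   nonpositive for large [k], it allows the sums to be extended to all [k]. *)
Definition kernel (x v a : R) (k : nat) : R :=
  exp (- (INR k * x)) * (1 - a * (exp (INR k * v) + exp (- (INR k * v)) - 2)).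

Lemma kernel_sum (W : nat -> R) x v a K :
  sum_f_R0 (fun k => W k * kernel x v a k) K =
  (1 + 2 * a) * poly W K (exp (- x)) - a * poly W K (exp (- (x - v)))
    - a * poly W K (exp (- (x + v))).
Proof.
  unfold poly; rewrite !scal_sum, <- !minus_sum.
  apply sum_eq; intros k _; unfold kernel.
  rewrite !exp_neg_pow.
  replace (- (INR k * (x - v))) with (- (INR k * x) + INR k * v) by ring.
  replace (- (INR k * (x + v))) with (- (INR k * x) + - (INR k * v)) by ring.
  rewrite !exp_plus; ring.
Qed.

Lemma minorant_weight_0 : minorant_weight 0 = 0.
Proof. unfold minorant_weight, sigma1; simpl; ring. Qed.

Lemma sum_tail_nonpos f n n' : (n <= n')%nat ->
  (forall k, (n < k)%nat -> f k <= 0) -> sum_f_R0 f n' <= sum_f_R0 f n.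
Proof.
  intros H Hf; induction H as [|n' Hn IH]; [lra|].
  rewrite tech5; specialize (Hf (S n') ltac:(lia)); lra.
Qed.

(** Up to $k=j-29$, where the induction hypothesis applies, the kernel is below the ratio of
    growths; beyond, it is nonpositive. So its weighted sum over the admissible $k$ is at least its
    sum over all $k\le K$, which the Lambert series bound from below by $j$. *)
Lemma minorant_step A (h : nat -> R) (j : nat) :
  0 <= A -> nonneg h -> (284 <= j)%nat ->
  INR j * h j = conv minorant_weight h j ->
  (forall i, (29 <= i < j)%nat -> A * growth (INR i + 5) <= h i) ->
  A * growth (INR j + 5) <= h j.
Proof.
  intros HA Hh Hj Hrec IH.
  assert (HP := PI_gt_3); assert (HP4 := PI_4).
  assert (Hn : 289 <= INR j + 5).
  { assert (INR 284 <= INR j) by (apply le_INR; auto).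
    rewrite INR_IZR_INZ in H; simpl in H; lra. }
  set (n := INR j + 5) in *; set (w := / sqrt n).
  assert (HN : 17 <= sqrt n).
  { rewrite <- (sqrt_pow2 17) by lra; apply sqrt_le_1_alt; lra. }
  assert (Hw : 0 < w <= / 17).
  { unfold w; split; [apply Rinv_0_lt_compat; lra|apply Rinv_le_contravar; lra]. }
  assert (Hnw : n = / w ^ 2).
  { unfold w; rewrite <- (sqrt_sqrt n) at 1 by lra; field; lra. }
  set (x := 2 * PI * w - w ^ 2).
  set (th := PI / 2 * w ^ 3 * (1 + 13 * w ^ 2)).
  set (a := th / (x / 4) ^ 2); set (v := x / 4).
  assert (Hx : 0 < x <= / 2) by (unfold x; nra).
  assert (Hw3 : 0 < w ^ 3) by (apply pow_lt; lra).
  assert (Hth : 1.5 * w ^ 3 <= th).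
  { unfold th; rewrite <- (Rmult_1_r (1.5 * w ^ 3)).
    apply Rmult_le_compat; nra. }
  assert (Ha : 0 < a) by (unfold a; apply Rdiv_lt_0_compat; [|apply pow_lt]; lra).
  assert (Hav : a * v ^ 2 = th) by (unfold a, v; field; lra).
  assert (Hcosh : forall k, th * INR k ^ 2 * (1 + INR k ^ 2 * v ^ 2 / 12) <=
     a * (exp (INR k * v) + exp (- (INR k * v)) - 2)).
  { intros k; rewrite <- Hav.
    replace (a * v ^ 2 * INR k ^ 2 * (1 + INR k ^ 2 * v ^ 2 / 12)) with
      (a * ((INR k * v) ^ 2 + (INR k * v) ^ 4 / 12)) by field.
    apply Rmult_le_compat_l; [lra|]; apply cosh_quartic.
    apply Rmult_le_pos; [apply pos_INR|unfold v; lra]. }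
  assert (Hnear : forall k, (k <= j - 29)%nat ->
     growth n * kernel x v a k <= growth (n - INR k)).
  { intros k Hk.
    assert (HkR : INR k <= INR j - 29).
    { replace 29 with (INR 29) by (rewrite INR_IZR_INZ; reflexivity).
      rewrite <- minus_INR by lia; apply le_INR; auto. }
    assert (Hk0 := pos_INR k).
    apply Rle_trans with (2 := growth_ratio n w (INR k) (proj1 Hw) Hnw ltac:(unfold n; lra)).
    fold x; unfold kernel; rewrite Rmult_assoc.
    apply Rmult_le_compat_l; [apply Rlt_le, growth_pos; lra|].
    apply Rmult_le_compat_l; [apply Rlt_le, exp_pos|].
    specialize (Hcosh k).
    enough (PI / 2 * w ^ 3 * INR k ^ 2 * (1 + 3 * INR k * w ^ 2) <=
       th * INR k ^ 2 * (1 + INR k ^ 2 * v ^ 2 / 12)) by lra.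
    unfold th.
    replace (PI / 2 * w ^ 3 * (1 + 13 * w ^ 2) * INR k ^ 2 * (1 + INR k ^ 2 * v ^ 2 / 12))
      with (PI / 2 * w ^ 3 * INR k ^ 2 * ((1 + 13 * w ^ 2) * (1 + INR k ^ 2 * v ^ 2 / 12)))
      by ring.
    apply Rmult_le_compat_l.
    { apply Rmult_le_pos; [nra|apply pow2_ge_0]. }
    assert (Hv : 35 * w ^ 2 / 16 <= v ^ 2).
    { unfold v; replace ((x / 4) ^ 2) with (w ^ 2 * (2 * PI - w) ^ 2 / 16)
        by (unfold x; field).
      assert (35 <= (2 * PI - w) ^ 2) by nra.
      assert (0 < w ^ 2) by (apply pow_lt; lra); nra. }
    assert (H1 : INR k ^ 2 * (35 * w ^ 2 / 16) <= INR k ^ 2 * v ^ 2)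
      by (apply Rmult_le_compat_l; [apply pow2_ge_0|auto]).
    (* The constant 13 makes the discriminant negative, $9<4\cdot13\cdot35/192$, and 8.23 is close
       to the minimum of the difference. The factor $1+13w^2$ in [th] serves moderate $k$, the
       quartic term large $k$. *)
    assert (H2 : 3 * INR k <= 13 + INR k ^ 2 * 35 / 192) by (generalize (pow2_ge_0 (INR k - 8.23)); lra).
    assert (H3 : 3 * INR k * w ^ 2 <= (13 + INR k ^ 2 * 35 / 192) * w ^ 2)
      by (apply Rmult_le_compat_r; [apply pow2_ge_0|auto]).
    assert (H4 : 0 <= 13 * w ^ 2 * (INR k ^ 2 * v ^ 2 / 12)).
    { apply Rmult_le_pos; [|apply Rmult_le_pos; [apply Rmult_le_pos|lra]];
        try apply pow2_ge_0; generalize (pow2_ge_0 w); lra. }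
    lra. }
  assert (Hfar : forall k, (j - 29 < k)%nat -> kernel x v a k <= 0).
  { intros k Hk; unfold kernel.
    enough (1 <= a * (exp (INR k * v) + exp (- (INR k * v)) - 2)).
    { generalize (exp_pos (- (INR k * x))); nra. }
    apply Rle_trans with (2 := Hcosh k).
    assert (HkR : INR j - 29 <= INR k).
    { replace 29 with (INR 29) by (rewrite INR_IZR_INZ; reflexivity).
      rewrite <- minus_INR by lia; apply le_INR; lia. }
    (* Here $k\ge n-34$, and $34\le0.12\,n$ for $n\ge289$. *)
    assert (H1 : 0.88 * n <= INR k) by (unfold n in *; lra).
    assert (H2 : 1 <= th * INR k ^ 2).
    { apply Rle_trans with (1.5 * w ^ 3 * (0.88 * n) ^ 2).
      - rewrite Hnw; replace (1.5 * w ^ 3 * (0.88 * / w ^ 2) ^ 2) with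
          (1.5 * 0.88 ^ 2 * / w) by (field; lra).
        assert (17 <= / w) by (unfold w; rewrite Rinv_inv; auto); lra.
      - apply Rmult_le_compat; try apply pow2_ge_0; [lra|auto|].
        apply pow_incr; lra. }
    rewrite <- (Rmult_1_r 1); apply Rmult_le_compat; try lra.
    assert (0 <= INR k ^ 2 * v ^ 2) by (apply Rmult_le_pos; apply pow2_ge_0); lra. }
  destruct (poly_minorant_ge x (/ 100) Hx ltac:(lra)) as [K0 HK0].
  set (K := Nat.max K0 (j - 29)).
  assert (Hsum : INR j <= sum_f_R0 (fun k => minorant_weight k * kernel x v a k) K).
  { rewrite kernel_sum.
    assert (S0 := saddle_inequality w Hw); cbv zeta in S0; fold x th a v in S0.
    rewrite <- Hnw in S0; replace (n - 5) with (INR j) in S0 by (unfold n; ring).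
    apply Rle_trans with (1 := S0).
    assert (L := HK0 K ltac:(unfold K; lia)).
    assert (U1 := poly_minorant_le K (x - v) ltac:(unfold v; lra)).
    assert (U2 := poly_minorant_le K (x + v) ltac:(unfold v; lra)).
    apply (Rmult_le_compat_l (1 + 2 * a)) in L; [|lra].
    apply (Rmult_le_compat_l a) in U1; [|lra].
    apply (Rmult_le_compat_l a) in U2; [|lra].
    lra. }
  assert (Htail : sum_f_R0 (fun k => minorant_weight k * kernel x v a k) K <=
    sum_f_R0 (fun k => minorant_weight k * kernel x v a k) (j - 29)).
  { apply sum_tail_nonpos; [unfold K; lia|]; intros k Hk.
    specialize (Hfar k Hk); generalize (minorant_weight_nonneg k); nra. }
  assert (Hg : 0 <= A * growth n).
  { apply Rmult_le_pos; [auto|apply Rlt_le, growth_pos; lra]. }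
  assert (Hj0 : 0 < INR j) by (unfold n in *; lra).
  apply Rmult_le_reg_l with (INR j); [auto|].
  rewrite Hrec; unfold conv.
  (* The terms with $j-k<29$ lie outside the induction hypothesis; being nonnegative, they are
     dropped. *)
  apply Rle_trans with (sum_f_R0 (fun k => minorant_weight k * h (j - k)%nat) (j - 29)).
  2: { apply sum_f_R0_mono; [|lia]; intros k.
       apply Rmult_le_pos; [apply minorant_weight_nonneg|apply Hh]. }
  apply Rle_trans with
    (A * growth n * sum_f_R0 (fun k => minorant_weight k * kernel x v a k) (j - 29)).
  { rewrite Rmult_comm; apply Rmult_le_compat_l; lra. }
  rewrite scal_sum; apply sum_Rle; intros k Hk.
  (* The term $k=0$ would involve [h j] itself, but its weight is zero. *)
  destruct k as [|k]; [rewrite minorant_weight_0; lra|].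
  rewrite Rmult_assoc; apply Rmult_le_compat_l; [apply minorant_weight_nonneg|].
  apply Rle_trans with (2 := IH (j - S k)%nat ltac:(lia)).
  rewrite minus_INR by lia.
  replace (INR j - INR (S k) + 5) with (n - INR (S k)) by (unfold n; ring).
  specialize (Hnear (S k) Hk).
  apply (Rmult_le_compat_l A) in Hnear; [|auto]; lra.
Qed.

(** * Coefficients of j *)

(* Congruence of functions modulo [q^(M+1)] as [q -> 0+]. *)
Definition eqm (M : nat) (f g : R -> R) : Prop :=
  exists C, forall q, 0 < q <= / 4 -> Rabs (f q - g q) <= C * q ^ S M.

Definition bounded (f : R -> R) : Prop :=
  exists C, forall q, 0 < q <= / 4 -> Rabs (f q) <= C.

Lemma eqm_refl M f : eqm M f f.
Proof.
  exists 0; intros q Hq; unfold Rminus; rewrite Rplus_opp_r, Rabs_R0; lra.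
Qed.

Lemma eqm_sym M f g : eqm M f g -> eqm M g f.
Proof. intros [C H]; exists C; intros q Hq; rewrite Rabs_minus_sym; auto. Qed.

Lemma eqm_trans M f g h : eqm M f g -> eqm M g h -> eqm M f h.
Proof.
  intros [C H] [C' H']; exists (C + C'); intros q Hq.
  specialize (H q Hq); specialize (H' q Hq).
  replace (f q - h q) with ((f q - g q) + (g q - h q)) by ring.
  generalize (Rabs_triang (f q - g q) (g q - h q)); lra.
Qed.

Lemma eqm_ext M f g : (forall q, 0 < q <= / 4 -> f q = g q) -> eqm M f g.
Proof.
  intros H; exists 0; intros q Hq; rewrite H by auto.
  unfold Rminus; rewrite Rplus_opp_r, Rabs_R0; lra.
Qed.

Lemma eqm_bounded M f g : eqm M f g -> bounded g -> bounded f.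
Proof.
  intros [C H] [C' H']; exists (Rabs C + C'); intros q Hq.
  specialize (H q Hq); specialize (H' q Hq).
  replace (f q) with ((f q - g q) + g q) by ring.
  apply Rle_trans with (1 := Rabs_triang _ _).
  assert (Hp := pow_unit q (S M) ltac:(lra)).
  assert (C * q ^ S M <= Rabs C).
  { generalize (Rle_abs C) (Rabs_pos C); nra. }
  lra.
Qed.

Lemma eqm_mult M f f' g g' : eqm M f f' -> eqm M g g' -> bounded f' -> bounded g' ->
  eqm M (fun q => f q * g q) (fun q => f' q * g' q).
Proof.
  intros Hf Hg Bf' Bg'; assert (Bg := eqm_bounded M g g' Hg Bg').
  destruct Hf as [C H], Hg as [C' H'], Bf' as [B HB], Bg as [B' HB'].
  exists (Rabs C * B' + B * Rabs C'); intros q Hq.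
  specialize (H q Hq); specialize (H' q Hq); specialize (HB q Hq); specialize (HB' q Hq).
  replace (f q * g q - f' q * g' q) with ((f q - f' q) * g q + f' q * (g q - g' q)) by ring.
  apply Rle_trans with (1 := Rabs_triang _ _); rewrite !Rabs_mult.
  assert (Hp := pow_unit q (S M) ltac:(lra)).
  assert (Rabs (f q - f' q) <= Rabs C * q ^ S M) by (generalize (Rle_abs C); nra).
  assert (Rabs (g q - g' q) <= Rabs C' * q ^ S M) by (generalize (Rle_abs C'); nra).
  assert (Rabs (f q - f' q) * Rabs (g q) <= (Rabs C * q ^ S M) * B')
    by (apply Rmult_le_compat; auto using Rabs_pos).
  assert (Rabs (f' q) * Rabs (g q - g' q) <= B * (Rabs C' * q ^ S M))
    by (apply Rmult_le_compat; auto using Rabs_pos).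
  lra.
Qed.

Lemma poly_bounded a M : bounded (poly a M).
Proof.
  exists (sum_f_R0 (fun k => Rabs (a k)) M); intros q Hq; unfold poly.
  apply Rle_trans with (1 := Rsum_abs _ _).
  apply sum_Rle; intros k _; rewrite Rabs_mult.
  rewrite <- (Rmult_1_r (Rabs (a k))) at 2.
  apply Rmult_le_compat_l; [apply Rabs_pos|].
  rewrite Rabs_pos_eq by (apply pow_le; lra).
  apply pow_unit; lra.
Qed.

Lemma bounded_mult f g : bounded f -> bounded g -> bounded (fun q => f q * g q).
Proof.
  intros [C H] [C' H']; exists (C * C'); intros q Hq; rewrite Rabs_mult.
  apply Rmult_le_compat; auto using Rabs_pos.
Qed.

Lemma eqm_sum M N (f : nat -> R -> R) : (forall k, (k <= N)%nat -> eqm M (f k) (fun _ => 0)) ->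
  eqm M (fun q => sum_f_R0 (fun k => f k q) N) (fun _ => 0).
Proof.
  intros H; induction N as [|N IH]; [apply (H 0%nat); auto|].
  destruct IH as [C HC]; [auto|]; destruct (H (S N) (le_n _)) as [C' HC'].
  exists (C + C'); intros q Hq; specialize (HC q Hq); specialize (HC' q Hq).
  rewrite tech5; rewrite Rminus_0_r in *.
  apply Rle_trans with (1 := Rabs_triang _ _); lra.
Qed.

(** The product of the truncations exceeds the truncated convolution by [rest], all of whose
    monomials have degree above [M]. *)
Lemma poly_conv_eqm a b M : (0 < M)%nat ->
  eqm M (poly (conv a b) M) (fun q => poly a M q * poly b M q).
Proof.
  intros HM; apply eqm_sym.
  set (rest := fun q => sum_f_R0 (fun k => sum_f_R0 (fun l =>
     a (S (l + k)) * q ^ S (l + k) * (b (M - l)%nat * q ^ (M - l))) (Nat.pred (M - k)))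
     (Nat.pred M)).
  assert (E : forall q, poly a M q * poly b M q = poly (conv a b) M q + rest q).
  { intros q; unfold poly at 1 2; rewrite cauchy_finite by auto.
    f_equal; unfold poly; apply sum_eq; intros k _; unfold conv.
    rewrite Rmult_comm, scal_sum; apply sum_eq; intros i Hi.
    replace (q ^ k) with (q ^ i * q ^ (k - i)) by (rewrite <- pow_add; f_equal; lia).
    ring. }
  assert (Hr : eqm M rest (fun _ => 0)).
  { apply (eqm_sum M (Nat.pred M)); intros k Hk.
    apply (eqm_sum M); intros l Hl.
    exists (Rabs (a (S (l + k)) * b (M - l)%nat)); intros q Hq.
    rewrite Rminus_0_r.
    replace (a (S (l + k)) * q ^ S (l + k) * (b (M - l)%nat * q ^ (M - l)))
      with (a (S (l + k)) * b (M - l)%nat * (q ^ S M * q ^ k)).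
    - rewrite Rabs_mult; apply Rmult_le_compat_l; [apply Rabs_pos|].
      assert (0 < q ^ S M) by (apply pow_lt; lra).
      assert (0 < q ^ k <= 1) by (apply pow_unit; lra).
      rewrite Rabs_pos_eq; nra.
    - replace (q ^ S M * q ^ k) with (q ^ S (l + k) * q ^ (M - l))
        by (rewrite <- !pow_add; f_equal; lia).
      ring. }
  destruct Hr as [C HC]; exists C; intros q Hq.
  rewrite E; specialize (HC q Hq); rewrite Rminus_0_r in HC.
  replace (poly (conv a b) M q + rest q - poly (conv a b) M q) with (rest q) by ring; auto.
Qed.

Lemma poly_divq_eqm m a M : (0 < m)%nat ->
  eqm M (fun q => poly (divq m a) M q * (1 - q ^ m)) (poly a M).
Proof.
  intros Hm.
  assert (E : forall q, poly (divq m a) M q =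
     poly a M q + (if (m <=? M)%nat then q ^ m * poly (divq m a) (M - m) q else 0)).
  { intros q; rewrite <- poly_shift, <- poly_add, <- divq_fix by auto; reflexivity. }
  destruct (Nat.leb_spec m M) as [H|H].
  - set (b := divq m a) in *.
    assert (Hr : eqm M (fun q => q ^ m * (poly b M q - poly b (M - m) q)) (fun _ => 0)).
    { assert (T : forall q, q ^ m * (poly b M q - poly b (M - m) q) =
        sum_f_R0 (fun i => b (S (M - m) + i)%nat * q ^ (S (M - m) + i) * q ^ m) (M - S (M - m))).
      { intros q; unfold poly; rewrite (tech2 _ (M - m) M) by lia.
        rewrite <- scal_sum; ring. }
      apply (eqm_trans _ _ _ _ (eqm_ext M _ _ (fun q _ => T q))).
      apply (eqm_sum M); intros i Hi.
      exists (Rabs (b (S (M - m) + i)%nat)); intros q Hq; rewrite Rminus_0_r.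
      replace (b (S (M - m) + i)%nat * q ^ (S (M - m) + i) * q ^ m) with
        (b (S (M - m) + i)%nat * (q ^ S M * q ^ i)).
      - rewrite Rabs_mult; apply Rmult_le_compat_l; [apply Rabs_pos|].
        assert (0 < q ^ S M) by (apply pow_lt; lra).
        assert (0 < q ^ i <= 1) by (apply pow_unit; lra).
        rewrite Rabs_pos_eq; nra.
      - rewrite Rmult_assoc, <- !pow_add; do 2 f_equal; lia. }
    destruct Hr as [C HC]; exists C; intros q Hq; specialize (HC q Hq).
    rewrite Rminus_0_r in HC.
    replace (poly b M q * (1 - q ^ m) - poly a M q) with
      (- (q ^ m * (poly b M q - poly b (M - m) q))) by (rewrite (E q); ring).
    rewrite Rabs_Ropp; auto.
  - destruct (poly_bounded a M) as [C HC]; exists C; intros q Hq.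
    rewrite E, Rplus_0_r; specialize (HC q Hq).
    replace (poly a M q * (1 - q ^ m) - poly a M q) with (- (poly a M q * q ^ m)) by ring.
    rewrite Rabs_Ropp, Rabs_mult; apply Rmult_le_compat; auto using Rabs_pos.
    rewrite Rabs_pos_eq by (apply pow_le; lra).
    apply pow_antitone; [lra|lia].
Qed.

(** Once the lower coefficients agree, division by $q^n$ leaves $|d|\le Dq$ for the difference [d]
    at index $n$, for all small $q$. *)
Lemma poly_eqm_unique a b M : eqm M (poly a M) (poly b M) ->
  forall n, (n <= M)%nat -> a n = b n.
Proof.
  intros [C HC] n; induction n as [n IH] using lt_wf_ind; intros Hn.
  set (d := a n - b n).
  enough (d = 0) by (unfold d in *; lra).
  set (D := sum_f_R0 (fun k => Rabs (a k - b k)) M + Rabs C).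
  assert (HD : forall q, 0 < q <= / 4 -> Rabs d <= D * q).
  { intros q Hq; specialize (HC q Hq).
    assert (Hqn : 0 < q ^ n) by (apply pow_lt; lra).
    apply Rmult_le_reg_r with (q ^ n); [auto|].
    replace (Rabs d * q ^ n) with (Rabs (d * q ^ n))
      by (rewrite Rabs_mult, (Rabs_pos_eq (q ^ n)); lra).
    set (T := sum_f_R0 (fun k => if (k =? n)%nat then 0 else (a k - b k) * q ^ k) M).
    assert (E : poly a M q - poly b M q = d * q ^ n + T).
    { unfold poly, T; rewrite <- minus_sum.
      rewrite (sum_eq _ (fun k => (if (k =? n)%nat then d * q ^ n else 0) +
        (if (k =? n)%nat then 0 else (a k - b k) * q ^ k))).
      - rewrite sum_plus; f_equal.
        clear - Hn; induction Hn as [|M HM IH].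
        + destruct n as [|n]; [reflexivity|]; rewrite tech5, Nat.eqb_refl.
          rewrite (sum_eq _ (fun _ => 0)), sum_cte; [ring|].
          intros i Hi; destruct (Nat.eqb_spec i (S n)); [lia|auto].
        + rewrite tech5, IH; destruct (Nat.eqb_spec (S M) n); [lia|ring].
      - intros k _; destruct (Nat.eqb_spec k n) as [->|_]; unfold d; ring. }
    assert (HT : Rabs T <= sum_f_R0 (fun k => Rabs (a k - b k)) M * (q ^ S n)).
    { unfold T; apply Rle_trans with (1 := Rsum_abs _ _).
      rewrite Rmult_comm, scal_sum; apply sum_Rle; intros k Hk.
      destruct (Nat.eqb_spec k n) as [_|Hkn].
      - rewrite Rabs_R0; apply Rmult_le_pos; [apply Rabs_pos|apply pow_le; lra].
      - destruct (Nat.lt_ge_cases k n) as [Hlt|Hge].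
        { rewrite (IH k) by lia; rewrite (Rminus_diag_eq (b k) (b k) eq_refl).
          rewrite Rmult_0_l, Rabs_R0; lra. }
        rewrite Rabs_mult; apply Rmult_le_compat_l; [apply Rabs_pos|].
        rewrite Rabs_pos_eq by (apply pow_le; lra).
        apply pow_antitone; [lra|lia]. }
    assert (HS : q ^ S M <= q ^ S n) by (apply pow_antitone; [lra|lia]).
    replace (d * q ^ n) with ((poly a M q - poly b M q) - T) by lra.
    apply Rle_trans with (1 := Rabs_triang _ _); rewrite Rabs_Ropp.
    assert (C * q ^ S M <= Rabs C * q ^ S n).
    { apply Rle_trans with (Rabs C * q ^ S M).
      - apply Rmult_le_compat_r; [apply pow_le; lra|apply Rle_abs].
      - apply Rmult_le_compat_l; [apply Rabs_pos|auto]. }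
    unfold D; simpl in *; lra. }
  assert (HD0 : 0 <= D).
  { apply Rplus_le_le_0_compat; [apply cond_pos_sum; intros|]; apply Rabs_pos. }
  destruct (Req_dec d 0) as [|Hd]; [auto|exfalso].
  assert (Hd' := Rabs_pos_lt d Hd).
  set (q := Rmin (/ 4) (Rabs d / (2 * (D + 1)))).
  assert (Hq2 : 0 < Rabs d / (2 * (D + 1))) by (apply Rdiv_lt_0_compat; lra).
  assert (Hq : 0 < q <= / 4) by (unfold q; split; [apply Rmin_glb_lt; lra|apply Rmin_l]).
  specialize (HD q Hq).
  assert (q <= Rabs d / (2 * (D + 1))) by apply Rmin_r.
  assert ((D + 1) * (Rabs d / (2 * (D + 1))) = Rabs d / 2) by (field; lra).
  nra.
Qed.

(** * Restriction of $j$ to the imaginary axis *)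

Lemma nome_imag y : nome (0, y) = RtoC (exp (- (2 * PI * y))).
Proof.
  unfold nome, Cexp, RtoC, Ci, Cmult, Re, Im; simpl.
  replace ((2 * PI * 0 - 0 * 1) * 0 - (2 * PI * 1 + 0 * 0) * y) with (- (2 * PI * y)) by ring.
  replace ((2 * PI * 0 - 0 * 1) * y + (2 * PI * 1 + 0 * 0) * 0) with 0 by ring.
  rewrite cos_0, sin_0; f_equal; ring.
Qed.

Lemma Cpow_RtoC (q : R) n : Cpow (RtoC q) n = RtoC (q ^ n).
Proof.
  induction n as [|n IH]; [reflexivity|].
  simpl; rewrite IH, <- RtoC_mult; reflexivity.
Qed.

Lemma Clim_seq_RtoC u : Clim_seq (fun n => RtoC (u n)) = RtoC (real (Lim_seq u)).
Proof.
  unfold Clim_seq, RtoC; simpl; rewrite Lim_seq_const; reflexivity.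
Qed.

(** [Csum1] starts at index 1 and [sum_f_R0] at index 0, hence the condition on [f 0]; it holds for
    the Eisenstein series because [sigma3 0] is an empty sum. *)
Lemma Csum1_RtoC (f : nat -> R) : f 0%nat = 0 ->
  Csum1 (fun n => RtoC (f n)) = RtoC (real (Lim_seq (sum_f_R0 f))).
Proof.
  intros H0; rewrite <- Clim_seq_RtoC; unfold Csum1; f_equal.
  apply functional_extensionality; intros N.
  assert (A : forall l z, fold_right Cplus (RtoC z) (map (fun n => RtoC (f n)) l) =
    (fold_right Cplus (RtoC 0) (map (fun n => RtoC (f n)) l) + RtoC z)%C).
  { intros l z; induction l as [|a l IH]; simpl; [ring|rewrite IH; ring]. }
  induction N as [|N IH]; [simpl; rewrite H0; reflexivity|].
  rewrite seq_S, map_app, fold_right_app; simpl fold_right at 2.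
  rewrite <- RtoC_plus, A, IH, <- RtoC_plus, tech5; f_equal; simpl; ring.
Qed.

Fixpoint delta_prod (M : nat) (q : R) : R :=
  match M with O => 1 | S M' => delta_prod M' q * (1 - q ^ M) ^ 24 end.

Lemma Cprod1_RtoC (q : R) :
  Cprod1 (fun n => Cpow (RtoC 1 - Cpow (RtoC q) n) 24) =
  RtoC (real (Lim_seq (fun N => delta_prod N q))).
Proof.
  rewrite <- Clim_seq_RtoC; unfold Cprod1; f_equal.
  replace (fun n => Cpow (RtoC 1 - Cpow (RtoC q) n) 24) with
    (fun n => RtoC ((1 - q ^ n) ^ 24)).
  2: { apply functional_extensionality; intros n.
       rewrite Cpow_RtoC, <- RtoC_minus, Cpow_RtoC; reflexivity. }
  apply functional_extensionality; intros N.
  assert (A : forall l z, fold_right Cmult (RtoC z) (map (fun n => RtoC ((1 - q ^ n) ^ 24)) l) =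
    (fold_right Cmult (RtoC 1) (map (fun n => RtoC ((1 - q ^ n) ^ 24)) l) * RtoC z)%C).
  { intros l z; induction l as [|a l IH]; cbn [fold_right map]; [ring|rewrite IH; ring]. }
  induction N as [|N IH]; [reflexivity|].
  rewrite seq_S, map_app, fold_right_app.
  change (fold_right Cmult (RtoC 1) (map (fun n => RtoC ((1 - q ^ n) ^ 24)) (1 + N :: nil)%nat))
    with (Cmult (RtoC ((1 - q ^ S N) ^ 24)) (RtoC 1)).
  rewrite <- RtoC_mult, A, IH, <- RtoC_mult; f_equal.
  change (delta_prod (S N) q) with (delta_prod N q * (1 - q ^ S N) ^ 24); ring.
Qed.

Definition eisenstein4 (q : R) : R :=
  1 + 240 * real (Lim_seq (sum_f_R0 (fun n => INR (sigma3 n) * q ^ n))).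

Definition delta_limit (q : R) : R := real (Lim_seq (fun N => delta_prod N q)).

Lemma modular_j_imag (y : R) : let q := exp (- (2 * PI * y)) in
  delta_limit q <> 0 ->
  modular_j (0, y) = RtoC (eisenstein4 q ^ 3 / (q * delta_limit q)).
Proof.
  intros q Hd; unfold modular_j; rewrite nome_imag; fold q.
  rewrite Cprod1_RtoC; fold (delta_limit q).
  replace (fun n => (RtoC (INR (sigma3 n)) * Cpow (RtoC q) n)%C) with
    (fun n => RtoC (INR (sigma3 n) * q ^ n)).
  2: { apply functional_extensionality; intros n; rewrite Cpow_RtoC, RtoC_mult; reflexivity. }
  rewrite Csum1_RtoC by (simpl; ring).
  rewrite <- RtoC_mult, <- RtoC_plus, Cpow_RtoC, <- RtoC_mult, <- RtoC_div; [reflexivity|].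
  assert (0 < q) by apply exp_pos; apply Rmult_integral_contrapositive; split; auto; lra.
Qed.

Lemma is_series_Re (a : nat -> R) (l : C) :
  @is_series C_AbsRing C_NormedModule (fun n => RtoC (a n)) l ->
  @is_series R_AbsRing R_NormedModule a (Re l).
Proof.
  intros H; unfold is_series in *.
  apply (filterlim_ext (fun n => Re (sum_n (fun n => RtoC (a n)) n : C))).
  - intros n; induction n as [|n IH]; [rewrite !sum_O; reflexivity|].
    rewrite !sum_Sn, <- IH; reflexivity.
  - eapply filterlim_comp; [exact H|].
    intros P [e He]; exists e; intros z Hz; apply He; exact (proj1 Hz).
Qed.

Lemma real_j_series c q : is_j_coefficients c -> 0 < q < 1 -> delta_limit q <> 0 ->
  is_series (fun n => IZR (c n) * q ^ n)
    (eisenstein4 q ^ 3 / (q * delta_limit q) - / q).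
Proof.
  intros hc Hq Hd; assert (HP := PI_RGT_0).
  (* The point $iy$ of the imaginary axis whose nome is [q]. *)
  set (y := - ln q / (2 * PI)).
  assert (Hln : ln q < 0) by (rewrite <- ln_1; apply ln_increasing; lra).
  assert (Hy : 0 < y) by (unfold y; apply Rdiv_lt_0_compat; lra).
  assert (Eq : exp (- (2 * PI * y)) = q).
  { replace (- (2 * PI * y)) with (ln q) by (unfold y; field; lra); apply exp_ln; lra. }
  specialize (hc (0, y) Hy).
  rewrite modular_j_imag, nome_imag, Eq in hc by (rewrite Eq; auto).
  rewrite <- RtoC_inv, <- RtoC_minus in hc by lra.
  apply (is_series_Re (fun n => IZR (c n) * q ^ n) (RtoC _)).
  apply is_series_ext with (2 := hc).
  intros n; rewrite Cpow_RtoC, RtoC_mult; reflexivity.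
Qed.

(** Boundedness of $a_n2^{-n}$ makes the tail geometric with ratio at most 1/2 when $q\le1/4$; the
    interval in [eqm] is chosen for this. *)
Lemma series_eqm (a : nat -> R) (f : R -> R) M :
  (exists B, forall n, Rabs (a n) * (/ 2) ^ n <= B) ->
  (forall q, 0 < q <= / 4 -> is_series (fun n => a n * q ^ n) (f q)) ->
  eqm M f (poly a M).
Proof.
  intros [B HB] Hf.
  assert (HB0 : 0 <= B).
  { specialize (HB 0%nat); simpl in HB; generalize (Rabs_pos (a 0%nat)); lra. }
  exists (2 * B * 2 ^ S M); intros q Hq.
  assert (HN : forall N, Rabs (sum_n (fun n => a n * q ^ n) (S M + N) - poly a M q)
     <= 2 * B * 2 ^ S M * q ^ S M).
  { intros N; rewrite sum_n_Reals; unfold poly; rewrite (tech2 _ M (S M + N)) by lia.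
    replace (S M + N - S M)%nat with N by lia.
    match goal with |- Rabs (?u + ?v - ?u) <= _ => replace (u + v - u) with v by ring end.
    apply Rle_trans with (1 := Rsum_abs _ _).
    apply Rle_trans with (sum_f_R0 (fun i => B * (2 * q) ^ S M * (/ 2) ^ i) N).
    - apply sum_Rle; intros i _; rewrite Rabs_mult.
      rewrite (Rabs_pos_eq (q ^ _)) by (apply pow_le; lra).
      specialize (HB (S M + i)%nat).
      replace (q ^ (S M + i)) with ((/ 2) ^ (S M + i) * ((2 * q) ^ (S M + i))).
      2: { rewrite <- Rpow_mult_distr; f_equal; field. }
      rewrite <- Rmult_assoc, (Rmult_assoc B).
      apply Rmult_le_compat; auto.
      + apply Rmult_le_pos; [apply Rabs_pos|apply pow_le; lra].
      + apply pow_le; lra.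
      + rewrite pow_add; apply Rmult_le_compat_l; [apply pow_le; lra|].
        apply pow_incr; lra.
    - rewrite <- (sum_eq (fun i => (/ 2) ^ i * (B * (2 * q) ^ S M))) by (intros; ring).
      rewrite <- scal_sum, tech3 by lra.
      rewrite Rpow_mult_distr.
      assert (0 < (/ 2) ^ S N) by (apply pow_lt; lra).
      assert (0 <= B * (2 ^ S M * q ^ S M)).
      { apply Rmult_le_pos; [auto|apply Rmult_le_pos; apply pow_le; lra]. }
      replace ((1 - (/ 2) ^ S N) / (1 - / 2)) with (2 - 2 * (/ 2) ^ S N) by field.
      nra. }
  specialize (Hf q Hq).
  assert (L : is_lim_seq (fun N => Rabs (sum_n (fun n => a n * q ^ n) (S M + N) - poly a M q))
     (Rabs (f q - poly a M q))).
  { apply (is_lim_seq_abs _ (Finite _)).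
    apply (is_lim_seq_minus' _ _ (f q) (poly a M q)); [|apply is_lim_seq_const].
    apply is_lim_seq_ext with (fun N => sum_n (fun n => a n * q ^ n) (N + S M)).
    { intros; rewrite Nat.add_comm; reflexivity. }
    apply is_lim_seq_incr_n; exact Hf. }
  apply (is_lim_seq_le _ _ (Finite _) (Finite _) HN L (is_lim_seq_const _)).
Qed.

Definition eisenstein4_coef (n : nat) : R :=
  match n with O => 1 | S _ => 240 * INR (sigma3 n) end.

Lemma sigma3_le n : INR (sigma3 n) <= INR n ^ 4.
Proof.
  rewrite <- pow_INR; apply le_INR; unfold sigma3.
  assert (A : forall l, (forall d, In d l -> (d <= n)%nat) ->
    (list_sum (map (fun d => d ^ 3) (filter (fun d => n mod d =? 0) l)) <= length l * n ^ 3)%nat).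
  { induction l as [|d l IH]; intros Hl; [simpl; lia|].
    specialize (IH (fun d Hd => Hl d (or_intror Hd))).
    assert (d ^ 3 <= n ^ 3)%nat by (apply Nat.pow_le_mono_l, Hl; left; auto).
    cbn [filter]; destruct (n mod d =? 0)%nat; cbn [map length list_sum fold_right];
      fold (list_sum (map (fun d => d ^ 3)%nat (filter (fun d => n mod d =? 0)%nat l))); nia. }
  specialize (A (seq 1 n)); rewrite length_seq in A.
  replace (n ^ 4)%nat with (n * n ^ 3)%nat by (simpl; lia).
  apply A; intros d Hd; apply in_seq in Hd; lia.
Qed.

(** From $n\le10\cdot1.1^n$ follows $240n^4\le240\cdot10^4\cdot(1.1^4)^n$, and $1.1^4<1.5$. The
    ratio stays below 2, as [series_eqm] requires. *)
Lemma eisenstein4_coef_le n : Rabs (eisenstein4_coef n) <= 2400000 * (1.5) ^ n.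
Proof.
  destruct n as [|n]; [simpl; rewrite Rabs_R1; lra|].
  set (m := S n); change (eisenstein4_coef m) with (240 * INR (sigma3 m)).
  rewrite Rabs_pos_eq by (generalize (pos_INR (sigma3 m)); lra).
  apply Rle_trans with (240 * INR m ^ 4).
  { generalize (sigma3_le m); lra. }
  assert (B : INR m <= 10 * 1.1 ^ m).
  { generalize m; induction m0 as [|k IH]; [simpl; lra|].
    rewrite S_INR; simpl; generalize (pow_R1_Rle 1.1 k ltac:(lra)); lra. }
  assert (H : INR m ^ 4 <= (10 * 1.1 ^ m) ^ 4) by (apply pow_incr; split; [apply pos_INR|auto]).
  rewrite Rpow_mult_distr, <- pow_mult, Nat.mul_comm, pow_mult in H.
  assert ((1.1 ^ 4) ^ m <= 1.5 ^ m) by (apply pow_incr; lra).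
  lra.
Qed.

Lemma eisenstein4_series q : 0 < q <= / 4 ->
  is_series (fun n => eisenstein4_coef n * q ^ n) (eisenstein4 q).
Proof.
  intros Hq.
  assert (E : ex_series (fun n => eisenstein4_coef n * q ^ n)).
  { apply (ex_series_le (V := R_CompleteNormedModule) _ (fun n => 2400000 * (1.5 * q) ^ n)).
    - intros n; change (Rabs (eisenstein4_coef n * q ^ n) <= 2400000 * (1.5 * q) ^ n).
      rewrite Rabs_mult, (Rabs_pos_eq (q ^ n)), Rpow_mult_distr, <- Rmult_assoc
        by (apply pow_le; lra).
      apply Rmult_le_compat_r; [apply pow_le; lra|apply eisenstein4_coef_le].
    - apply (ex_series_scal (V := R_NormedModule)), ex_series_geom.
      rewrite Rabs_pos_eq; lra. }
  destruct (E : exists l : R, is_series (fun n => eisenstein4_coef n * q ^ n) l) as [l Hl].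
  replace (eisenstein4 q) with l; [exact Hl|].
  assert (P : forall N, sum_f_R0 (fun n => INR (sigma3 n) * q ^ n) N =
    / 240 * (sum_n (fun n => eisenstein4_coef n * q ^ n) N - 1)).
  { intros N; rewrite sum_n_Reals; induction N as [|N IH].
    - change (0 * 1 = / 240 * (1 * 1 - 1)); field.
    - rewrite !tech5, IH.
      change (eisenstein4_coef (S N)) with (240 * INR (sigma3 (S N))); field. }
  unfold eisenstein4; rewrite (Lim_seq_ext _ _ P).
  rewrite (is_lim_seq_unique _ (/ 240 * (l - 1))).
  - simpl; field.
  - apply (is_lim_seq_scal_l _ (/ 240) (Finite (l - 1))).
    apply is_lim_seq_minus'; [exact Hl|apply is_lim_seq_const].
Qed.

Lemma delta_prod_step M q : 0 < q < 1 -> 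
  0 < delta_prod M q <= 1 /\
  delta_prod (S M) q <= delta_prod M q /\
  delta_prod M q - 24 * q ^ S M * delta_prod M q <= delta_prod (S M) q.
Proof.
  intros Hq.
  assert (B : forall k, 0 < (1 - q ^ S k) ^ 24 <= 1 /\ 1 - 24 * q ^ S k <= (1 - q ^ S k) ^ 24).
  { intros k; assert (0 < q ^ S k < 1).
    { split; [apply pow_lt; lra|]; apply pow_lt_1_compat; [lra|lia]. }
    set (t := q ^ S k) in *; split; [split|].
    - apply pow_lt; lra.
    - rewrite <- (pow1 24); apply pow_incr; lra.
    - assert (G : forall j, 1 - INR j * t <= (1 - t) ^ j).
      { induction j as [|j IH]; [simpl; lra|].
        rewrite S_INR; simpl; generalize (pos_INR j) (pow_le (1 - t) j ltac:(lra)); intros.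
        nra. }
      specialize (G 24%nat); rewrite INR_IZR_INZ in G; exact G. }
  assert (P : forall k, 0 < delta_prod k q <= 1).
  { induction k as [|k IH]; [simpl; lra|].
    change (delta_prod (S k) q) with (delta_prod k q * (1 - q ^ S k) ^ 24).
    specialize (B k); nra. }
  split; [apply P|].
  change (delta_prod (S M) q) with (delta_prod M q * (1 - q ^ S M) ^ 24).
  specialize (B M); specialize (P M); split; nra.
Qed.

(** Telescoping Bernoulli's inequality $(1-q^k)^{24}\ge1-24q^k$ bounds the relative loss after index
    [M] by $24q^{M+1}/(1-q)\le48q^{M+1}$. *)
Lemma delta_limit_bounds M q : 0 < q <= / 2 ->
  0 < delta_limit q /\ Rabs (delta_prod M q - delta_limit q) <= 48 * q ^ S M
   /\ delta_limit q <= 1.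
Proof.
  intros Hq; assert (Hq' : 0 < q < 1) by lra.
  assert (G : forall M N, delta_prod M q * (1 - 24 * (q ^ S M - q ^ S (M + N)) / (1 - q)) <=
    delta_prod (M + N) q <= delta_prod M q).
  { clear M; intros M N; induction N as [|N IH].
    - rewrite Nat.add_0_r; unfold Rminus at 2; rewrite Rplus_opp_r; lra.
    - destruct (delta_prod_step (M + N) q Hq') as [P1 [P2 P3]].
      rewrite Nat.add_succ_r; split; [|lra].
      apply Rle_trans with (2 := P3).
      replace (24 * (q ^ S M - q ^ S (S (M + N))) / (1 - q)) with
        (24 * (q ^ S M - q ^ S (M + N)) / (1 - q) + 24 * q ^ S (M + N)) by (simpl; field; lra).
      assert (0 < q ^ S (M + N)) by (apply pow_lt; lra).
      nra. }
  assert (X : exists l : R, is_lim_seq (fun N => delta_prod N q) l).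
  { destruct (ex_finite_lim_seq_decr (fun N => delta_prod N q) 0) as [l Hl].
    - intros n; destruct (delta_prod_step n q Hq'); lra.
    - intros n; destruct (delta_prod_step n q Hq'); lra.
    - exists l; exact Hl. }
  destruct X as [l Hl].
  replace (delta_limit q) with l
    by (unfold delta_limit; rewrite (is_lim_seq_unique _ _ Hl); reflexivity).
  assert (B : forall M, delta_prod M q * (1 - 48 * q ^ S M) <= l <= delta_prod M q).
  { intros K; destruct (delta_prod_step K q Hq') as [PK _].
    assert (L := proj1 (is_lim_seq_incr_n _ K _) Hl).
    split.
    - apply (is_lim_seq_le (fun _ => delta_prod K q * (1 - 48 * q ^ S K))
        (fun N => delta_prod (N + K) q) (Finite _) (Finite _)); [|apply is_lim_seq_const|exact L].
      intros N; rewrite Nat.add_comm; apply Rle_trans with (2 := proj1 (G K N)).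
      apply Rmult_le_compat_l; [lra|].
      assert (0 < q ^ S K) by (apply pow_lt; lra).
      assert (0 < q ^ S (K + N)) by (apply pow_lt; lra).
      enough (24 * (q ^ S K - q ^ S (K + N)) / (1 - q) <= 48 * q ^ S K) by lra.
      apply Rmult_le_reg_r with (1 - q); [lra|].
      replace (24 * (q ^ S K - q ^ S (K + N)) / (1 - q) * (1 - q)) with
        (24 * (q ^ S K - q ^ S (K + N))) by (field; lra).
      nra.
    - apply (is_lim_seq_le (fun N => delta_prod (N + K) q) (fun _ => delta_prod K q)
        (Finite _) (Finite _)); [|exact L|apply is_lim_seq_const].
      intros N; rewrite Nat.add_comm; apply G. }
  (* Positivity of the limit is read off at index 6, where $48\cdot2^{-7}<1$. *)
  destruct (delta_prod_step 6 q Hq') as [P2 _].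
  destruct (delta_prod_step M q Hq') as [PM _].
  assert (q ^ 7 <= (/ 2) ^ 7) by (apply pow_incr; lra).
  assert (0 < q ^ S M) by (apply pow_lt; lra).
  destruct (B M) as [B1 B2]; destruct (B 6%nat) as [B3 B4].
  split; [|split].
  - apply Rlt_le_trans with (2 := B3); apply Rmult_lt_0_compat; lra.
  - rewrite Rabs_pos_eq by lra; nra.
  - lra.
Qed.

Lemma inv_delta_eqm K M : (0 < K)%nat ->
  eqm K (fun q => poly (inv_delta M) K q * delta_prod M q) (fun _ => 1).
Proof.
  intros HK.
  assert (Bm : forall m, bounded (fun q => 1 - q ^ m)).
  { intros m; exists 1; intros q Hq.
    assert (0 < q ^ m <= 1) by (apply pow_unit; lra).
    rewrite Rabs_pos_eq; lra. }
  assert (Bmj : forall m j, bounded (fun q => (1 - q ^ m) ^ j)).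
  { intros m j; induction j as [|j IH].
    - exists 1; intros q _; simpl; rewrite Rabs_R1; lra.
    - apply (bounded_mult _ _ (Bm m) IH). }
  assert (I : forall m j a, (0 < m)%nat ->
    eqm K (fun q => poly (Nat.iter j (divq m) a) K q * (1 - q ^ m) ^ j) (poly a K)).
  { intros m j a Hm; induction j as [|j IH].
    - apply eqm_ext; intros; simpl; ring.
    - set (b := Nat.iter j (divq m) a) in *.
      change (Nat.iter (S j) (divq m) a) with (divq m b).
      apply eqm_trans with (2 := IH).
      apply eqm_trans with
        (fun q => (poly (divq m b) K q * (1 - q ^ m)) * (1 - q ^ m) ^ j).
      + apply eqm_ext; intros; simpl; ring.
      + apply eqm_mult; [apply poly_divq_eqm; auto|apply eqm_refl|apply poly_bounded|auto]. }
  assert (Bd : forall M, bounded (delta_prod M)).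
  { intros m; exists 1; intros q Hq; destruct (delta_prod_step m q) as [? _]; [lra|].
    rewrite Rabs_pos_eq; lra. }
  induction M as [|M IH].
  - apply eqm_ext; intros q _; simpl; rewrite poly_unit; ring.
  - apply eqm_trans with (2 := IH).
    apply eqm_trans with
      (fun q => (poly (inv_delta (S M)) K q * (1 - q ^ S M) ^ 24) * delta_prod M q).
    + apply eqm_ext; intros q _.
      change (delta_prod (S M) q) with (delta_prod M q * (1 - q ^ S M) ^ 24); ring.
    + apply eqm_mult; [apply (I (S M) 24%nat); lia|apply eqm_refl|apply poly_bounded|auto].
Qed.

(** Coefficients of $qj$: the leading 1 is the polar term, so [c n] sits at index [n + 1]. *)
Definition j_coef (c : nat -> Z) (n : nat) : R :=
  match n with O => 1 | S k => IZR (c k) end.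

Definition j_conv (M : nat) : nat -> R :=
  conv eisenstein4_coef (conv eisenstein4_coef (conv eisenstein4_coef (inv_delta M))).

(** No inverse of a congruence is taken: $J=qj$ times the finite product is congruent to $E_4^3$
    because that product is within $48q^{M+1}$ of its limit, and multiplying by the polynomial of
    [inv_delta M] removes the product again. *)
Lemma j_coef_conv c M n : is_j_coefficients c -> (0 < M)%nat -> (n <= M)%nat ->
  j_coef c n = j_conv M n.
Proof.
  intros hc HM Hn.
  apply (poly_eqm_unique _ _ M); [|auto].
  set (J := fun q => eisenstein4 q ^ 3 / delta_limit q).
  assert (HJs : forall q, 0 < q < 1 -> delta_limit q <> 0 ->
     is_series (fun n => j_coef c n * q ^ n) (J q)).
  { intros q Hq Hd.
    assert (S := real_j_series c q hc Hq Hd).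
    apply (is_series_scal (K := R_AbsRing) (V := R_NormedModule) q) in S.
    change (is_series (fun n => q * (IZR (c n) * q ^ n))
      (q * (eisenstein4 q ^ 3 / (q * delta_limit q) - / q))) in S.
    assert (E : q * (eisenstein4 q ^ 3 / (q * delta_limit q) - / q) = J q + - (1 * 1))
      by (unfold J; field; lra).
    rewrite E in S; apply is_series_decr_1.
    apply is_series_ext with (2 := S); intros k; simpl; ring. }
  assert (EJ : eqm M J (poly (j_coef c) M)).
  { apply series_eqm.
    - destruct (delta_limit_bounds 0 (/ 2) ltac:(lra)) as [Hd _].
      (* Convergence at $q=1/2$ forces the terms there to tend to 0, hence to be bounded, which is
         the growth condition of [series_eqm]. *)
      specialize (HJs (/ 2) ltac:(lra) ltac:(lra)).
      assert (L := ex_series_lim_0 _ (ex_intro _ _ HJs)).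
      destruct (filterlim_bounded (V := R_NormedModule) _ (ex_intro _ 0 L)) as [B HB].
      exists B; intros k; rewrite <- (Rabs_pos_eq ((/ 2) ^ k)) by (apply pow_le; lra).
      rewrite <- Rabs_mult; exact (HB k).
    - intros q Hq; destruct (delta_limit_bounds 0 q ltac:(lra)) as [Hd _].
      apply HJs; lra. }
  assert (E4 : eqm M eisenstein4 (poly eisenstein4_coef M)).
  { apply series_eqm; [|apply eisenstein4_series].
    exists 2400000; intros k.
    apply Rle_trans with (2400000 * (1.5 ^ k * (/ 2) ^ k)).
    - rewrite <- Rmult_assoc; apply Rmult_le_compat_r; [apply pow_le; lra|].
      apply eisenstein4_coef_le.
    - rewrite <- Rpow_mult_distr.
      assert ((1.5 * / 2) ^ k <= 1 ^ k) by (apply pow_incr; lra).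
      rewrite pow1 in H; lra. }
  assert (BJ : bounded J) by (apply (eqm_bounded M _ _ EJ), poly_bounded).
  assert (Bp := poly_bounded).
  set (p := poly (inv_delta M) M) in *; set (e := poly eisenstein4_coef M) in *.
  assert (ED : eqm M (fun q => J q * delta_prod M q) (fun q => eisenstein4 q ^ 3)).
  { destruct BJ as [B HB]; exists (B * 48); intros q Hq.
    destruct (delta_limit_bounds M q ltac:(lra)) as [Hd [Hd' _]].
    replace (J q * delta_prod M q - eisenstein4 q ^ 3) with
      (J q * (delta_prod M q - delta_limit q)) by (unfold J; field; lra).
    rewrite Rabs_mult, Rmult_assoc.
    apply Rmult_le_compat; auto using Rabs_pos. }
  assert (Be : bounded e) by apply poly_bounded.
  assert (E43 : eqm M (fun q => eisenstein4 q ^ 3) (fun q => e q * (e q * e q))).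
  { apply eqm_trans with (fun q => eisenstein4 q * (eisenstein4 q * eisenstein4 q)).
    - apply eqm_ext; intros; ring.
    - apply eqm_mult; auto; [apply eqm_mult; auto|apply bounded_mult; auto]. }
  apply eqm_trans with (1 := eqm_sym _ _ _ EJ).
  apply eqm_trans with (fun q => J q * (p q * delta_prod M q)).
  { apply eqm_trans with (fun q => J q * 1); [apply eqm_ext; intros; ring|].
    apply eqm_mult; auto; [apply eqm_refl| |].
    - apply eqm_sym, inv_delta_eqm; auto.
    - apply (eqm_bounded M _ _ (inv_delta_eqm M M HM)).
      exists 1; intros; rewrite Rabs_R1; lra. }
  apply eqm_trans with (fun q => (J q * delta_prod M q) * p q).
  { apply eqm_ext; intros; ring. }
  apply eqm_trans with (fun q => e q * (e q * e q) * p q).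
  { apply eqm_mult; [apply eqm_trans with (1 := ED); auto|apply eqm_refl| |apply Bp].
    apply bounded_mult; [|apply bounded_mult]; auto. }
  apply eqm_trans with (fun q => e q * (e q * (e q * p q))).
  { apply eqm_ext; intros; ring. }
  assert (C : forall b f, eqm M (poly b M) f -> bounded f ->
     eqm M (poly (conv eisenstein4_coef b) M) (fun q => e q * f q)).
  { intros b f Hb Bf; apply eqm_trans with (1 := poly_conv_eqm _ b M HM).
    apply eqm_mult; auto; apply eqm_refl. }
  apply eqm_sym; unfold j_conv.
  apply C; [apply C; [apply C; [apply eqm_refl|apply Bp]|]|];
    repeat apply bounded_mult; auto; apply Bp.
Qed.

(** * The minorant of the coefficients and its recurrence *)

Lemma conv_mono a a' b b' : nonneg a' -> nonneg b ->
  (forall n, a n <= a' n) -> (forall n, b n <= b' n) ->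
  forall n, conv a b n <= conv a' b' n.
Proof.
  intros Ha Hb Haa Hbb n; apply sum_Rle; intros k _.
  apply Rle_trans with (a' k * b (n - k)%nat).
  - apply Rmult_le_compat_r; auto.
  - apply Rmult_le_compat_l; auto.
Qed.

(* [240 k^3 >= 240 (k^3 - k)], the coefficients of [1440 q^2 / (1 - q)^4]. *)
Definition eisenstein4_minorant : nat -> R :=
  scale 1440 (shift 2 (Nat.iter 4 (divq 1) unit_seq)).

Lemma sigma3_ge n : (0 < n)%nat -> INR n ^ 3 <= INR (sigma3 n).
Proof.
  intros Hn; rewrite <- pow_INR; apply le_INR; unfold sigma3.
  destruct n as [|k]; [lia|]; rewrite seq_S, filter_app, map_app, list_sum_app.
  cbn [filter]; rewrite Nat.Div0.mod_same; cbn [Nat.eqb map]; cbn [list_sum fold_right].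
  replace (1 + k)%nat with (S k) by lia; lia.
Qed.

Lemma eisenstein4_minorant_le n : eisenstein4_minorant n <= eisenstein4_coef n.
Proof.
  unfold eisenstein4_minorant, scale; rewrite shift_val.
  destruct (Nat.leb_spec 2 n) as [H|H].
  - rewrite divq1_4_unit, minus_INR by lia; change (INR 2) with 2.
    destruct n as [|k]; [lia|].
    change (eisenstein4_coef (S k)) with (240 * INR (sigma3 (S k))).
    generalize (sigma3_ge (S k) ltac:(lia)) (pos_INR (S k)).
    set (r := INR (S k)); intros; nra.
  - destruct n as [|k]; [simpl; lra|].
    change (eisenstein4_coef (S k)) with (240 * INR (sigma3 (S k))).
    generalize (pos_INR (sigma3 (S k))); lra.
Qed.

Lemma eisenstein4_coef_nonneg : nonneg eisenstein4_coef.
Proof.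
  intros [|n]; [simpl; lra|].
  change (0 <= 240 * INR (sigma3 (S n))); generalize (pos_INR (sigma3 (S n))); lra.
Qed.

Lemma eisenstein4_minorant_nonneg : nonneg eisenstein4_minorant.
Proof.
  intros n; unfold eisenstein4_minorant, scale; rewrite shift_val.
  destruct (2 <=? n)%nat; [|lra].
  enough (0 <= Nat.iter 4 (divq 1) unit_seq (n - 2)%nat) by lra.
  apply divq_iter_nonneg; intros [|k]; simpl; lra.
Qed.

(* [(1 - q)^(-12) prod_(m <= M) (1 - q^m)^(-24)]. *)
Definition minorant (M : nat) : nat -> R := Nat.iter 12 (divq 1) (inv_delta M).

(** Each of the three factors $1440q^2(1-q)^{-4}$ contributes a shift by 2 and four divisions by
    $1-q$; this gives the [n + 6] and the 12 in [minorant]. *)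
Lemma j_conv_ge M n : 1440 ^ 3 * minorant M n <= j_conv M (n + 6).
Proof.
  assert (Hp := inv_delta_nonneg M).
  assert (Hm := eisenstein4_minorant_nonneg).
  assert (He := eisenstein4_coef_nonneg).
  assert (Hme := eisenstein4_minorant_le).
  assert (E : forall a, conv eisenstein4_minorant a =
     scale 1440 (shift 2 (Nat.iter 4 (divq 1) a))).
  { intros a; unfold eisenstein4_minorant.
    rewrite conv_scalel, conv_shiftl, divq_iter_conv, conv_unitl by lia; reflexivity. }
  apply Rle_trans with
    (conv eisenstein4_minorant (conv eisenstein4_minorant
      (conv eisenstein4_minorant (inv_delta M))) (n + 6)%nat).
  - rewrite !E.
    assert (C : forall j r m a, Nat.iter j (divq 1) (scale r (shift m a)) =
      scale r (shift m (Nat.iter j (divq 1) a))).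
    { intros j r m a; induction j as [|j IH]; [reflexivity|].
      cbn [Nat.iter nat_rect]; unfold Nat.iter in IH; rewrite IH; unfold divq at 1.
      rewrite conv_scaler, conv_shiftr; reflexivity. }
    rewrite C, C, C.
    unfold scale; rewrite !shift_val.
    destruct (Nat.leb_spec 2 (n + 6)); [|lia].
    destruct (Nat.leb_spec 2 (n + 6 - 2)); [|lia].
    destruct (Nat.leb_spec 2 (n + 6 - 2 - 2)); [|lia].
    replace (n + 6 - 2 - 2 - 2)%nat with n by lia.
    apply Req_le; unfold minorant; simpl; ring.
  - assert (M1 : forall a b, nonneg a -> (forall k, a k <= b k) ->
      forall k, conv eisenstein4_minorant a k <= conv eisenstein4_coef b k).
    { intros; apply conv_mono; auto. }
    apply M1; [|apply M1; [|apply M1]]; auto using conv_nonneg; intros; lra.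
Qed.

Lemma minorant_nonneg M : nonneg (minorant M).
Proof. apply divq_iter_nonneg, inv_delta_nonneg. Qed.

Lemma conv_ext_l a a' b n : (forall k, (k <= n)%nat -> a k = a' k) -> conv a b n = conv a' b n.
Proof. intros H; apply sum_eq; intros; rewrite H; auto. Qed.

Lemma inv_delta_rec M n : (n <= M)%nat ->
  INR n * inv_delta M n = conv (scale 24 sigma1) (inv_delta M) n.
Proof.
  intros Hn; assert (E := f_equal (fun f => f n) (euler_inv_delta M)); cbv beta in E.
  unfold euler in E; rewrite E; apply conv_ext_l; intros k Hk.
  unfold scale; rewrite sigma1_stable by lia; reflexivity.
Qed.

Lemma minorant_rec M n : (n <= M)%nat ->
  INR n * minorant M n = conv minorant_weight (minorant M) n.
Proof.
  intros Hn.
  assert (E := f_equal (fun f => f n)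
    (euler_divq_iter 12 1 _ _ Nat.lt_0_1 (euler_inv_delta M))); cbv beta in E.
  unfold euler in E; fold (minorant M) in E; rewrite E; apply conv_ext_l; intros k Hk.
  unfold seq_add, scale, minorant_weight; rewrite sigma1_stable by lia; simpl INR; ring.
Qed.

Lemma divq_at_0 m a : (0 < m)%nat -> divq m a 0 = a 0%nat.
Proof.
  intros Hm; unfold divq, conv, multiples; simpl.
  rewrite Nat.Div0.mod_0_l; simpl; ring.
Qed.

Lemma divq_iter_at_0 j m a : (0 < m)%nat -> Nat.iter j (divq m) a 0%nat = a 0%nat.
Proof.
  intros Hm; induction j as [|j IH]; [reflexivity|].
  change (divq m (Nat.iter j (divq m) a) 0%nat = a 0%nat); rewrite divq_at_0; auto.
Qed.

Lemma inv_delta_at_0 M : inv_delta M 0 = 1.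
Proof.
  induction M as [|M IH]; [reflexivity|].
  change (Nat.iter 24 (divq (S M)) (inv_delta M) 0%nat = 1).
  rewrite divq_iter_at_0 by lia; auto.
Qed.

Lemma minorant_at_0 M : minorant M 0 = 1.
Proof. unfold minorant; rewrite divq_iter_at_0 by lia; apply inv_delta_at_0. Qed.

(** * Certified computation *)

Lemma PI_le : PI <= 3.1416.
Proof.
  destruct (PI_2_3_7_ineq 2) as [_ H].
  unfold tg_alt, PI_2_3_7_tg, Ratan_seq in H; simpl in H; lra.
Qed.

(** $e^{0.693/16}$ is bounded by the cubic and then squared four times with upward rounding, ending
    at 2. *)
Lemma ln_2_ge : 0.693 <= ln 2.
Proof.
  assert (D : forall t u v, exp t <= u -> u * u <= v -> exp (2 * t) <= v).
  { intros t u v H1 H2; replace (2 * t) with (t + t) by ring; rewrite exp_plus.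
    apply Rle_trans with (2 := H2); generalize (exp_pos t); intros.
    apply Rmult_le_compat; lra. }
  assert (H0 : exp (0.693 / 16) <= 1.044266737).
  { apply Rle_trans with (1 := exp_le_cubic (0.693 / 16) ltac:(lra)); lra. }
  apply D with (v := 1.090493019) in H0; [|lra].
  apply D with (v := 1.189175025) in H0; [|lra].
  apply D with (v := 1.414137241) in H0; [|lra].
  apply D with (v := 2) in H0; [|lra].
  replace (2 * (2 * (2 * (2 * (0.693 / 16))))) with 0.693 in H0 by field.
  rewrite <- (ln_exp 0.693); apply ln_le; [apply exp_pos|auto].
Qed.

(* A certificate that [exp (4 PI sqrt n) <= sqrt 2 * X] with [X = n y]: the eighth
   powers are compared through [2^r] with [r >= 32 PI sqrt n / ln 2], using the
   leading bits of [X]; [21050 >= (32 PI / ln 2)^2]. *)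
Definition exp_bound_test (n y : Z) : bool :=
  let X := (n * y)%Z in
  let s := Z.max 0 (Z.log2 X - 30) in
  let t := Z.shiftr X s in
  ((0 <? t) && (Z.sqrt (21050 * n) + 1 <=? 8 * s + 4 + Z.log2 (t ^ 8)))%Z%bool.

Lemma exp_bound_test_correct n y : (0 < n)%nat ->
  exp_bound_test (Z.of_nat n) y = true ->
  exp (4 * PI * sqrt (INR n)) / (sqrt 2 * INR n) <= IZR y.
Proof.
  intros Hn Ht; unfold exp_bound_test in Ht; apply andb_prop in Ht; destruct Ht as [Ht Hr].
  apply Z.ltb_lt in Ht; apply Z.leb_le in Hr.
  set (X := (Z.of_nat n * y)%Z) in *.
  set (s := Z.max 0 (Z.log2 X - 30)) in *.
  set (t := Z.shiftr X s) in *.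
  set (r := (Z.sqrt (21050 * Z.of_nat n) + 1)%Z) in *.
  assert (Hs0 : (0 <= s)%Z) by (unfold s; lia).
  assert (HtX : (t * 2 ^ s <= X)%Z).
  { unfold t; rewrite Z.shiftr_div_pow2 by auto; rewrite Z.mul_comm.
    apply Z.mul_div_le; apply Z.pow_pos_nonneg; lia. }
  assert (Hr0 : (1 <= r)%Z) by (unfold r; generalize (Z.sqrt_nonneg (21050 * Z.of_nat n)); lia).
  (* The factor 16 is $(\sqrt2)^8$ and accounts for the summand 4 in the test. *)
  assert (H2r : (2 ^ r <= 16 * X ^ 8)%Z).
  { apply Z.le_trans with (2 ^ (8 * s + 4 + Z.log2 (t ^ 8)))%Z.
    - apply Z.pow_le_mono_r; lia.
    - rewrite !Z.pow_add_r by (try lia; apply Z.log2_nonneg).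
      assert (Ht8 : (0 < t ^ 8)%Z) by (apply Z.pow_pos_nonneg; lia).
      apply Z.le_trans with (2 ^ (8 * s) * 2 ^ 4 * t ^ 8)%Z.
      + apply Z.mul_le_mono_nonneg_l.
        * apply Z.mul_nonneg_nonneg; apply Z.pow_nonneg; lia.
        * apply Z.log2_spec; auto.
      + replace (2 ^ (8 * s) * 2 ^ 4 * t ^ 8)%Z with (16 * (t * 2 ^ s) ^ 8)%Z.
        * apply Z.mul_le_mono_nonneg_l; [lia|]; apply Z.pow_le_mono_l.
          split; [apply Z.mul_nonneg_nonneg; [lia|apply Z.pow_nonneg; lia]|auto].
        * rewrite Z.pow_mul_l, <- Z.pow_mul_r by lia.
          rewrite (Z.mul_comm s 8); change (2 ^ 4)%Z with 16%Z; ring. }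
  assert (Hr2 : (21050 * Z.of_nat n <= r * r)%Z).
  { unfold r; destruct (Z.sqrt_spec (21050 * Z.of_nat n)) as [_ H]; lia. }
  assert (HX0 : (0 < X)%Z).
  { assert (0 < 2 ^ s)%Z by (apply Z.pow_pos_nonneg; lia); nia. }
  assert (HnR : 0 < INR n) by (apply lt_0_INR; auto).
  assert (HXR : IZR X = INR n * IZR y) by (unfold X; rewrite mult_IZR, <- INR_IZR_INZ; auto).
  assert (HrR : 21050 * INR n <= IZR r ^ 2).
  { replace (IZR r ^ 2) with (IZR (r * r)) by (rewrite mult_IZR; ring).
    rewrite INR_IZR_INZ, <- mult_IZR; apply IZR_le; auto. }
  assert (Hr1 : 0 < IZR r) by (apply IZR_lt; lia).
  assert (HP := PI_le); assert (HP3 := PI_gt_3); assert (HL := ln_2_ge).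
  assert (Hsq := sqrt_pos (INR n)); assert (Hsq2 := sqrt_sqrt (INR n) ltac:(lra)).
  assert (Hexp : 32 * PI * sqrt (INR n) <= IZR r * ln 2).
  { apply Rsqr_incr_0_var; [|apply Rmult_le_pos; lra].
    unfold Rsqr.
    replace (32 * PI * sqrt (INR n) * (32 * PI * sqrt (INR n))) with
      (1024 * PI ^ 2 * (sqrt (INR n) * sqrt (INR n))) by ring.
    rewrite Hsq2.
    replace (IZR r * ln 2 * (IZR r * ln 2)) with (IZR r ^ 2 * ln 2 ^ 2) by ring.
    apply Rle_trans with (21050 * INR n * 0.693 ^ 2).
    - replace (21050 * INR n * 0.693 ^ 2) with (21050 * 0.693 ^ 2 * INR n) by ring.
      apply Rmult_le_compat_r; [lra|].
      assert (PI ^ 2 <= 3.1416 ^ 2) by (apply pow_incr; lra); lra.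
    - apply Rmult_le_compat; auto; try lra; apply pow_incr; lra. }
  assert (Hs2 : 0 < sqrt 2) by (apply sqrt_lt_R0; lra).
  assert (Hs4 := sqrt_sqrt 2 ltac:(lra)).
  set (e := exp (4 * PI * sqrt (INR n))).
  assert (He8 : e ^ 8 <= (sqrt 2 * IZR X) ^ 8).
  { replace (e ^ 8) with (exp (32 * PI * sqrt (INR n))).
    2: { unfold e; 
         replace (32 * PI * sqrt (INR n)) with (INR 8 * (4 * PI * sqrt (INR n)))
           by (rewrite INR_IZR_INZ; simpl; ring).
         generalize (4 * PI * sqrt (INR n)); intros z.
         generalize 8%nat; intros k; induction k as [|k IH].
         - simpl; rewrite Rmult_0_l, exp_0; reflexivity.
         - rewrite S_INR, Rmult_plus_distr_r, Rmult_1_l, exp_plus, IH; simpl; ring. }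
    apply Rle_trans with (exp (IZR r * ln 2)).
    { destruct Hexp as [H|H]; [apply Rlt_le, exp_increasing; auto|rewrite H; lra]. }
    replace (exp (IZR r * ln 2)) with (IZR (2 ^ r)).
    - replace ((sqrt 2 * IZR X) ^ 8) with ((sqrt 2 * sqrt 2) ^ 4 * IZR X ^ 8) by ring.
      rewrite Hs4; apply IZR_le in H2r.
      replace (2 ^ 4 * IZR X ^ 8) with (IZR (16 * X ^ 8)); auto.
      rewrite mult_IZR, (pow_IZR X 8); simpl; ring.
    - replace r with (Z.of_nat (Z.to_nat r)) by (rewrite Z2Nat.id; lia).
      rewrite <- pow_IZR, <- INR_IZR_INZ, <- Rpower_pow by lra; reflexivity. }
  assert (HX1 : 0 < IZR X) by (apply IZR_lt; auto).
  assert (He : e <= sqrt 2 * IZR X).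
  { destruct (Rle_dec e (sqrt 2 * IZR X)) as [|H]; [auto|exfalso].
    assert (0 < sqrt 2 * IZR X) by (apply Rmult_lt_0_compat; auto).
    assert ((sqrt 2 * IZR X) ^ 8 < e ^ 8); [|lra].

    set (b := sqrt 2 * IZR X) in *.
    assert (b ^ 2 < e ^ 2) by nra. assert (b ^ 4 < e ^ 4).
    { replace (b ^ 4) with ((b ^ 2) ^ 2) by ring; replace (e ^ 4) with ((e ^ 2) ^ 2) by ring; nra. }
    replace (b ^ 8) with ((b ^ 4) ^ 2) by ring; replace (e ^ 8) with ((e ^ 4) ^ 2) by ring.
    assert (0 < b ^ 4) by (apply pow_lt; auto); nra. }
  apply Rmult_le_reg_r with (sqrt 2 * INR n); [apply Rmult_lt_0_compat; auto|].
  replace (e / (sqrt 2 * INR n) * (sqrt 2 * INR n)) with e by (field; lra).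
  rewrite HXR in He; lra.
Qed.

(* [rev_table f k l] says that [l] lists [f k], [f (k - 1)], ..., [f 0]. *)
Fixpoint rev_table (f : nat -> R) (k : nat) (l : list Z) : Prop :=
  match k, l with
  | O, [x] => f 0%nat = IZR x
  | S k', x :: l' => f k = IZR x /\ rev_table f k' l'
  | _, _ => False
  end.

(** Against a reversed table a convolution becomes an inner product of lists read from their heads;
    the shorter list ends the sum. *)
Fixpoint dot (u v : list Z) : Z :=
  match u, v with
  | a :: u', b :: v' => (a * b + dot u' v')%Z
  | _, _ => 0%Z
  end.

Lemma dot_conv u a f k l : (k < length u)%nat ->
  (forall i, (i <= k)%nat -> a i = IZR (nth i u 0%Z)) ->
  rev_table f k l -> IZR (dot u l) = conv a f k.
Proof.
  revert u a l; induction k as [|k IH]; intros [|z u] a l Hu Ha Hl;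
    try (simpl in Hu; lia); destruct l as [|x l]; try (destruct Hl; fail).
  - destruct l; [|destruct Hl]; simpl in Hl.
    unfold conv; simpl; rewrite Hl, (Ha 0%nat) by lia; simpl nth.
    replace (dot u []) with 0%Z by (destruct u; reflexivity).
    rewrite Z.add_0_r, mult_IZR; reflexivity.
  - destruct Hl as [Hx Hl].
    assert (E : conv a f (S k) = a 0%nat * f (S k) + conv (fun i => a (S i)) f k).
    { unfold conv; rewrite decomp_sum by lia; reflexivity. }
    rewrite E, <- (IH u _ l); auto.
    + rewrite (Ha 0%nat) by lia; rewrite Hx; simpl nth; simpl dot.
      rewrite plus_IZR, mult_IZR; reflexivity.
    + simpl in Hu; lia.
    + intros i Hi; rewrite (Ha (S i)) by lia; reflexivity.
Qed.

Fixpoint divisor_sum (k : Z) (m : nat) : Z :=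
  match m with
  | O => 0
  | S m' => divisor_sum k m' + (if k mod Z.of_nat m =? 0 then Z.of_nat m else 0)
  end%Z.

Lemma divisor_sum_correct k : IZR (divisor_sum (Z.of_nat (S k)) (S k)) = sigma1 (S k).
Proof.
  unfold sigma1; generalize (S k) at 2 4; intros m; induction m as [|m IH].
  - simpl; ring.
  - rewrite tech5, <- IH; cbn [divisor_sum]; rewrite plus_IZR; f_equal.
    unfold log_weight, multiples.
    rewrite <- Nat2Z.inj_mod.
    change 0%Z with (Z.of_nat 0) at 1.
    destruct (Nat.eqb_spec (S k mod S m) 0) as [->|H].
    + rewrite INR_IZR_INZ; simpl (_ =? _)%Z; cbv iota; ring.
    + destruct (Z.eqb_spec (Z.of_nat (S k mod S m)) (Z.of_nat 0)); [lia|ring].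
Qed.

(* Runs the recurrence [j f(j) = sum_(k >= 1) w_k f(j - k)] on the reversed table
   [acc] of [f 0], ..., [f (j - 1)], and tests every new value. *)
Fixpoint run_recurrence (test : Z -> Z -> bool) (w : list Z) (fuel : nat) (j : Z)
    (acc : list Z) : option (list Z) :=
  match fuel with
  | O => Some acc
  | S fuel' =>
    let (x, r) := Z.div_eucl (dot w acc) j in
    if ((r =? 0) && test j x)%Z%bool
    then run_recurrence test w fuel' (j + 1) (x :: acc) else None
  end.

(** Integrality of [f] is not assumed: the test on the remainder certifies it value by value.
    Position [i] of [w] holds [W (i + 1)], since [W 0] vanishes and [acc] starts at $f(j)$ when
    $f(j+1)$ is computed. *)
Lemma run_recurrence_correct test W f w M :
  W 0%nat = 0 ->
  (forall i, (i < M)%nat -> W (S i) = IZR (nth i w 0%Z)) -> (M <= length w)%nat ->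
  (forall n, (n <= M)%nat -> INR n * f n = conv W f n) ->
  forall fuel j acc l, (j + fuel <= M)%nat -> rev_table f j acc ->
  run_recurrence test w fuel (Z.of_nat (S j)) acc = Some l ->
  rev_table f (j + fuel) l /\
  forall i, (j < i <= j + fuel)%nat ->
    exists x, f i = IZR x /\ test (Z.of_nat i) x = true.
Proof.
  intros HW0 HW HwM Hf fuel; induction fuel as [|fuel IH]; intros j acc l HM Hacc Hrun.
  - injection Hrun as <-; rewrite Nat.add_0_r; split; [auto|intros; lia].
  - cbn [run_recurrence] in Hrun.
    destruct (Z.div_eucl (dot w acc) (Z.of_nat (S j))) as [x r] eqn:E.
    destruct (r =? 0)%Z eqn:Er; [|discriminate].
    destruct (test (Z.of_nat (S j)) x) eqn:Et; [|discriminate].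
    cbn [andb] in Hrun; apply Z.eqb_eq in Er; subst r.
    assert (Ed : dot w acc = (Z.of_nat (S j) * x)%Z).
    { generalize (Z_div_mod_full (dot w acc) (Z.of_nat (S j)) ltac:(lia)).
      rewrite E; lia. }
    assert (Hx : f (S j) = IZR x).
    { assert (HS : 0 < INR (S j)) by (apply lt_0_INR; lia).
      apply Rmult_eq_reg_l with (INR (S j)); [|lra].
      rewrite Hf by lia; unfold conv; rewrite decomp_sum by lia.
      rewrite HW0, Rmult_0_l, Rplus_0_l; simpl Nat.pred.
      rewrite INR_IZR_INZ, <- mult_IZR, <- Ed.
      rewrite (dot_conv w (fun i => W (S i)) f j acc); [reflexivity|lia| |auto].
      intros i Hi; apply HW; lia. }
    replace (Z.of_nat (S j) + 1)%Z with (Z.of_nat (S (S j))) in Hrun by lia.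
    destruct (IH (S j) (x :: acc) l ltac:(lia) (conj Hx Hacc) Hrun) as [H1 H2].
    rewrite Nat.add_succ_r; split; [exact H1|]; intros i Hi.
    destruct (Nat.eq_dec i (S j)) as [->|Hn]; [exists x; auto|apply H2; lia].
Qed.

(** The tails of a reversed table are the reversed tables of the shorter prefixes, so one inner
    product per tail yields the whole convolution, again reversed. *)
Fixpoint conv_table (u l : list Z) : list Z :=
  match l with [] => [] | _ :: l' => dot u l :: conv_table u l' end.

Lemma conv_table_correct u a f k l : (k < length u)%nat ->
  (forall i, (i <= k)%nat -> a i = IZR (nth i u 0%Z)) ->
  rev_table f k l -> rev_table (conv a f) k (conv_table u l).
Proof.
  revert l; induction k as [|k IH]; intros [|x l] Hu Ha Hl; try (destruct Hl; fail).
  - assert (D := dot_conv u a f 0 (x :: l) Hu Ha Hl).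
    destruct l; [|destruct Hl]; cbn [conv_table rev_table]; auto.
  - assert (D := dot_conv u a f (S k) (x :: l) Hu Ha Hl).
    cbn [conv_table rev_table]; split; [auto|].
    apply IH; [lia|intros; apply Ha; lia|apply Hl].
Qed.

Lemma rev_table_nth f k l i : rev_table f k l -> (i <= k)%nat ->
  f i = IZR (nth (k - i) l 0%Z).
Proof.
  revert l; induction k as [|k IH]; intros [|x l] Hl Hi; try (destruct Hl; fail).
  - destruct l; [|destruct Hl]; replace i with 0%nat by lia; exact Hl.
  - destruct Hl as [Hx Hl]; destruct (Nat.eq_dec i (S k)) as [->|Hn].
    + rewrite Nat.sub_diag; exact Hx.
    + rewrite Nat.sub_succ_l by lia; apply IH; [auto|lia].
Qed.

(** The weights 1 to 283 reach $j=283$, that is $n=288$, the last value before [minorant_step]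
    applies. *)
Definition minorant_weights : list Z :=
  map (fun k => 12 + 24 * divisor_sum (Z.of_nat k) k)%Z (seq 1 283).

Lemma nth_map_seq (g : nat -> Z) s i N : (i < N)%nat -> nth i (map g (seq s N)) 0%Z = g (s + i)%nat.
Proof.
  intros H; rewrite (nth_indep _ 0%Z (g 0%nat)) by (rewrite length_map, length_seq; auto).
  rewrite map_nth, seq_nth; auto.
Qed.

Lemma minorant_weight_succ k : minorant_weight (S k) =
  IZR (12 + 24 * divisor_sum (Z.of_nat (S k)) (S k)).
Proof.
  rewrite plus_IZR, mult_IZR, divisor_sum_correct; unfold minorant_weight, log_weight, multiples.
  rewrite Nat.mod_1_r; simpl; ring.
Qed.

(* Index [j] stands for [n = j + 5]; the test fails below [n = 34]. *)
Definition minorant_test (j x : Z) : bool :=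
  ((j <? 29) || exp_bound_test (j + 5) (1440 ^ 3 * x))%Z%bool.

Lemma minorant_run :
  match run_recurrence minorant_test minorant_weights 283 1 [1%Z] with
  | Some _ => true | None => false end = true.
Proof. vm_compute; reflexivity. Qed.

Lemma minorant_base M i : (283 <= M)%nat -> (29 <= i <= 283)%nat ->
  exp (4 * PI * sqrt (INR i + 5)) / (sqrt 2 * (INR i + 5)) <= 1440 ^ 3 * minorant M i.
Proof.
  intros HM Hi.
  assert (R := minorant_run).
  destruct (run_recurrence minorant_test minorant_weights 283 1 [1%Z]) as [l|] eqn:E;
    [|discriminate]; clear R.
  destruct (run_recurrence_correct minorant_test minorant_weight (minorant M) minorant_weights 283
    minorant_weight_0) with (fuel := 283%nat) (j := 0%nat) (acc := [1%Z]) (l := l) as [_ H]; auto.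
  - intros k Hk; unfold minorant_weights; rewrite nth_map_seq by auto.
    apply minorant_weight_succ.
  - intros n Hn; apply minorant_rec; lia.
  - apply minorant_at_0.
  - destruct (H i) as [x [Hx Ht]]; [lia|].
    unfold minorant_test in Ht; apply Bool.orb_prop in Ht; destruct Ht as [Ht|Ht].
    { apply Z.ltb_lt in Ht; lia. }
    replace (Z.of_nat i + 5)%Z with (Z.of_nat (i + 5)) in Ht by lia.
    apply exp_bound_test_correct in Ht; [|lia].
    rewrite plus_INR in Ht; replace (INR 5) with 5 in Ht by (simpl; ring).
    rewrite mult_IZR in Ht; change (1440 ^ 3)%Z with 2985984000%Z in Ht.
    rewrite Hx; replace (1440 ^ 3) with 2985984000 by ring; exact Ht.
Qed.

Definition delta_weights : list Z :=
  map (fun k => 24 * divisor_sum (Z.of_nat k) k)%Z (seq 1 34).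

Definition eisenstein4_table : list Z :=
  map (fun k => if (k =? 0)%nat then 1 else 240 * Z.of_nat (sigma3 k))%Z (seq 0 35).

(** Degree 34 is the index of [c 33] in $qj$. The full $E_4$ is used here instead of its minorant,
    which is too small for these $n$. *)
Definition j_table : list Z :=
  match run_recurrence (fun _ _ => true) delta_weights 34 1 [1%Z] with
  | Some l =>
    conv_table eisenstein4_table (conv_table eisenstein4_table (conv_table eisenstein4_table l))
  | None => []
  end.

Lemma j_table_correct n : (n <= 34)%nat -> j_conv 34 n = IZR (nth (34 - n) j_table 0%Z).
Proof.
  intros Hn; unfold j_table.
  destruct (run_recurrence (fun _ _ => true) delta_weights 34 1 [1%Z]) as [l|] eqn:E.
  2: { exfalso; revert E; vm_compute; discriminate. }
  destruct (run_recurrence_correct (fun _ _ => true) (scale 24 sigma1) (inv_delta 34)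
    delta_weights 34) with (fuel := 34%nat) (j := 0%nat) (acc := [1%Z]) (l := l) as [H _]; auto.
  - unfold scale, sigma1; simpl; ring.
  - intros k Hk; unfold delta_weights; rewrite nth_map_seq by auto.
    rewrite mult_IZR, divisor_sum_correct; reflexivity.
  - intros k Hk; apply inv_delta_rec; auto.
  - apply inv_delta_at_0.
  - assert (C : forall f t, rev_table f 34 t ->
      rev_table (conv eisenstein4_coef f) 34 (conv_table eisenstein4_table t)).
    { intros f t; apply conv_table_correct; [vm_compute; lia|].
      intros i Hi; unfold eisenstein4_table; rewrite nth_map_seq by lia.
      destruct i as [|i]; [reflexivity|].
      change (240 * INR (sigma3 (S i)) = IZR (240 * Z.of_nat (sigma3 (S i)))).
      rewrite mult_IZR, <- INR_IZR_INZ; reflexivity. }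
    apply rev_table_nth; auto; apply C, C, C, H.
Qed.

Lemma j_table_test :
  forallb (fun n => exp_bound_test (Z.of_nat n) (nth (33 - n) j_table 0%Z)) (seq 2 32) = true.
Proof. vm_compute; reflexivity. Qed.

(** The constant is dictated by the theorem, not by the asymptotics of [minorant]; the surplus in
    the exponent of $n$ lets every step preserve it unchanged. *)
Lemma minorant_lower_bound M j : (29 <= j <= M)%nat -> (283 <= M)%nat ->
  growth (INR j + 5) <= sqrt 2 * 1440 ^ 3 * minorant M j.
Proof.
  intros Hj HM; assert (Hs : 0 < sqrt 2) by (apply sqrt_lt_R0; lra).
  set (A := / (sqrt 2 * 1440 ^ 3)).
  assert (HA : 0 < A) by (apply Rinv_0_lt_compat; lra).
  enough (A * growth (INR j + 5) <= minorant M j).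
  { apply Rmult_le_reg_l with A; [auto|].
    replace (A * (sqrt 2 * 1440 ^ 3 * minorant M j)) with (minorant M j)
      by (unfold A; field; lra); auto. }
  induction j as [j IH] using lt_wf_ind.
  destruct (Nat.le_gt_cases j 283) as [H|H].
  - assert (B := minorant_base M j HM ltac:(lia)).
    unfold A, growth; assert (0 <= INR j) by apply pos_INR.
    apply Rmult_le_reg_l with (1440 ^ 3); [lra|].
    apply Rle_trans with (2 := B); apply Req_le; field; lra.
  - apply minorant_step; [lra|apply minorant_nonneg|lia|apply minorant_rec; lia|].
    intros i Hi; apply IH; lia.
Qed.

Theorem theorem2p3 (c : nat -> Z) (hc : is_j_coefficients c)
    (n : nat) (hn : (2 <= n)%nat) :
  exp (4 * PI * sqrt (INR n)) / (sqrt 2 * INR n) <= IZR (c n).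
Proof.
  destruct (Nat.le_gt_cases n 33) as [H|H].
  - assert (E := j_coef_conv c 34 (S n) hc ltac:(lia) ltac:(lia)).
    rewrite j_table_correct in E by lia; replace (34 - S n)%nat with (33 - n)%nat in E by lia.
    simpl j_coef in E; rewrite E.
    apply exp_bound_test_correct; [lia|].
    assert (T := j_table_test); rewrite forallb_forall in T.
    apply (T n), in_seq; lia.
  (* Large enough both for the index $n+1$ and for the computed range up to 283. *)
  - set (M := (n + 283)%nat).
    assert (E := j_coef_conv c M (S n) hc ltac:(lia) ltac:(lia)).
    simpl j_coef in E; rewrite E.
    assert (L := j_conv_ge M (n - 5)).
    replace (n - 5 + 6)%nat with (S n) in L by lia.
    apply Rle_trans with (2 := L).
    assert (T := minorant_lower_bound M (n - 5) ltac:(lia) ltac:(lia)).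
    rewrite minus_INR in T by lia; replace (INR 5) with 5 in T by (simpl; ring).
    replace (INR n - 5 + 5) with (INR n) in T by ring.
    assert (Hs : 0 < sqrt 2) by (apply sqrt_lt_R0; lra).
    assert (0 < INR n) by (apply lt_0_INR; lia).
    apply Rmult_le_reg_l with (sqrt 2); [auto|].
    replace (sqrt 2 * (exp (4 * PI * sqrt (INR n)) / (sqrt 2 * INR n))) with (growth (INR n))
      by (unfold growth; field; lra).
    lra.
Qed.
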